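(* For a finite poset $S$, a triangular algebra $\Lambda$ and a vertex $v$ in its quiver, \[ \phi_{\Lambda\xleftarrow{v}\widehat{S}}(x)=\phi_\Lambda(x)\cdot\phi_S(x)+\phi_{\Lambda^-}(x)\cdot\phi_{\widehat{S}}(x)-(x+1)\cdot\phi_{\Lambda^-}(x)\cdot\phi_S(x). \]
   Context: Let $K$ be a field. For a finite quiver $Q$ with vertex set $Q_0$ and arrow set $Q_1$, write $h(\alpha)$ and $t(\alpha)$ for the vertices at which an arrow (or path) $\alpha$ starts and ends, respectively; paths are composed from left to right, and two paths $p,q$ are parallel if $h(p)=h(q)$ and $t(p)=t(q)$. A triangular algebra is a quotient $\Lambda = KQ/I$ where $Q$ is a finite quiver without oriented cycles and $I$ is an ideal generated by linear combinations of parallel paths of lengths at least $2$. Its Cartan matrix $C_\Lambda$ is indexed by $Q_0$, with $(C_\Lambda)_{ij} = \dim_K \mathrm{Hom}_\Lambda(P_i,P_j)$, $P_i = e_i\Lambda$; this is the dimension of the image in $KQ/I$ of the span of paths from $j$ to $i$. Its Coxeter polynomial is $\phi_\Lambda(x) = \det(xC_\Lambda + C_\Lambda^T)$ (equal to $1$ for the zero algebra). For $v\in Q_0$, $e_v$ is the corresponding primitive idempotent and $\Lambda^- = (1-e_v)\Lambda(1-e_v)$. For a finite poset $S$, $C_S$ is the $S\times S$ matrix with $(C_S)_{st}=1$ if $t\le s$ and $0$ otherwise (the Cartan matrix of the incidence algebra $KS$), and $\phi_S(x)=\det(xC_S+C_S^T)$, $\phi_\varnothing=1$. The poset $\widehat{S}=S\cup\{\widehat{1}\}$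 is obtained by adjoining a new element $\widehat 1$ with $s<\widehat{1}$ for all $s\in S$. The Hasse quiver $Q_S$ has the elements of $S$ as vertices and an arrow $s\to s'$ whenever $s'$ covers $s$. $S_{\min}$ and $S_{\max}$ are the sets of minimal and maximal elements of $S$. Insertion: let $\Lambda = KQ/I$ be a triangular algebra, $v\in Q_0$, $S$ a nonempty finite poset. The insertion $\Lambda \xleftarrow{v} S$ is $K\widetilde{Q}/\widetilde{I}$, where $\widetilde{Q}_0 = (Q_0\setminus\{v\})\cup S$, and $\widetilde{Q}_1$ consists of: the arrows $\gamma\in Q_1$ with $h(\gamma),t(\gamma)\ne v$; the arrows of $Q_S$; an arrow $(\alpha,s)$ from $h(\alpha)$ to $s$ for each $\alpha\in Q_1$ with $t(\alpha)=v$ and $s\in S_{\min}$; an arrow $(s,\beta)$ from $s$ to $t(\beta)$ for each $\beta\in Q_1$ with $h(\beta)=v$ and $s\in S_{\max}$. For a path $p$ in $Q$ ending at $v$ and $s\in S_{\min}$, let $(p,s)$ be obtained from $p$ by replacing its last arrow $\alpha$ by $(\alpha,s)$; define $(s,p)$ similarly for $p$ starting at $v$ and $s\in S_{\max}$. The ideal $\widetilde{I}$ is generated by: (1a) $\sum c_p (p,s)$ for $s\in S_{\min}$ and $\sum c_p p\in I$ a linear combination of parallel paths ending at $v$; (1b) $\sum c_p (s,p)$ for $s\in S_{\max}$ and $\sum c_p p\in I$ a linear combination of parallel paths starting at $v$; (2a) $q'-q''$ for parallel paths $q',q''$ in $Q_S$; (2b) $(\alpha,h(q'))q' - (\alpha,h(q''))q''$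 for $\alpha\in Q_1$ ending at $v$ and paths $q',q''$ in $Q_S$ with $h(q'),h(q'')\in S_{\min}$, $t(q')=t(q'')$; (2c) $q'(t(q'),\beta)-q''(t(q''),\beta)$ for $\beta\in Q_1$ starting at $v$ and paths $q',q''$ in $Q_S$ with $t(q'),t(q'')\in S_{\max}$, $h(q')=h(q'')$; (2d) $(\alpha,h(q'))q'(t(q'),\beta)-(\alpha,h(q''))q''(t(q''),\beta)$ for $\alpha,\beta\in Q_1$ with $t(\alpha)=h(\beta)=v$ and paths $q',q''$ in $Q_S$ with $h(q'),h(q'')\in S_{\min}$, $t(q'),t(q'')\in S_{\max}$; (3) $\sum c_p\widetilde{p}$ for $\sum c_p p\in I$ a linear combination of parallel paths neither starting nor ending at $v$, where $\widetilde{p}=p$ if $p$ does not pass through $v$, and otherwise, writing $p=p'p''$ with $t(p')=h(p'')=v$, $\widetilde{p} = (p',h(q))\,q\,(t(q),p'')$ for some path $q$ in $Q_S$ with $h(q)\in S_{\min}$, $t(q)\in S_{\max}$ (the choice of $q$ is irrelevant modulo the other relations). The algebra $\Lambda\xleftarrow{v}S$ is again triangular. *)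

(* Defs.v *)
From HB Require Import structures.
From mathcomp Require Import all_boot all_order all_algebra.
From mathcomp Require Import boolp.

Set Implicit Arguments.
Unset Strict Implicit.
Unset Printing Implicit Defensive.

Import Order.TTheory GRing.Theory.
Local Open Scope ring_scope.

Definition coxeter_poly (I : finType) (C : I -> I -> nat) : {poly int} :=
  let M : 'M[int]_#|I| :=
    \matrix_(i, j) (C (enum_val i) (enum_val j))%:Z in
  \det ('X *: map_mx polyC M + map_mx polyC M^T).

Section Span.
Variables (K : fieldType) (V : vectType K).
Implicit Types (X : V -> Prop) (U W : {vspace V}).

Lemma vspan_ex X : exists U, (forall x, X x -> x \in U) /\
  (forall W, (forall x, X x -> x \in W) -> (U <= W)%VS).
Proof.
pose P n := `[< exists2 s : seq V, (forall x, x \in s -> X x)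
                  & \dim <<s>>%VS = n >].
have exP : exists n, P n by exists 0%N; apply/asboolP; exists [::] => //;
  rewrite span_nil dimv0.
have ubP n : P n -> (n <= \dim {:V})%N.
  by move=> /asboolP[s _ <-]; apply: dimvS; apply: subvf.
case: (ex_maxnP exP ubP) => n /asboolP[s sX ds] maxn.
exists <<s>>%VS; split=> [x Xx|W XW]; last first.
  by apply/span_subvP => x /sX /XW.
have sub : (<<s>> <= <<x :: s>>)%VS by rewrite span_cons addvSr.
have eqs : <<s>>%VS = <<x :: s>>%VS.
  apply/eqP; rewrite eqEdim sub ds; apply: maxn; apply/asboolP.
  exists (x :: s); last by [].
  by move=> y; rewrite in_cons => /orP[/eqP -> | /sX].
by rewrite eqs memv_span // mem_head.
Qed.

Definition vspan X : {vspace V} := sval (cid (vspan_ex X)).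

Lemma mem_vspan X x : X x -> x \in vspan X.
Proof. by have [h _] := svalP (cid (vspan_ex X)); apply: h. Qed.

Lemma vspan_subvP X W : (forall x, X x -> x \in W) -> (vspan X <= W)%VS.
Proof. by have [_ h] := svalP (cid (vspan_ex X)); apply: h. Qed.

Lemma vspan_id X : X 0 -> (forall k x y, X x -> X y -> X (k *: x + y)) ->
  forall x, x \in vspan X <-> X x.
Proof.
move=> X0 Xlin x; split; last exact: mem_vspan.
move=> Ux.
pose P n := `[< exists2 W : {vspace V}, (forall x, x \in W -> X x)
                  & \dim W = n >].
have exP : exists n, P n.
  exists 0%N; apply/asboolP; exists 0%VS; last exact: dimv0.
  by move=> y; rewrite memv0 => /eqP ->.
have ubP n : P n -> (n <= \dim {:V})%N.
  by move=> /asboolP[W _ <-]; apply: dimvS; apply: subvf.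
case: (ex_maxnP exP ubP) => n /asboolP[W WX dW] maxn.
apply: (WX); apply: (subvP (vspan_subvP _)) Ux => y Xy.
have sub : (W <= <[y]> + W)%VS by rewrite addvSr.
have -> : W = (<[y]> + W)%VS.
  apply/eqP; rewrite eqEdim sub dW; apply: maxn; apply/asboolP.
  exists (<[y]> + W)%VS => // z /memv_addP[_ /vlineP[k ->]] [w /WX Xw ->].
  exact: Xlin.
by rewrite (subvP (addvSl _ _)) // memv_line.
Qed.

End Span.

(* The library's falgType forces 1 != 0; here the zero algebra is allowed. *)
HB.mixin Record Vector_isUnitalAlg (K : fieldType) A of Vector K A := {
  amul : A -> A -> A;
  aone : A;
  amulA : associative amul;
  amul1l : left_id aone amul;
  amul1r : right_id aone amul;
  amulPl : forall (k : K) (x y z : A),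
    amul (k *: x + y) z = k *: amul x z + amul y z;
  amulPr : forall (k : K) (x y z : A),
    amul z (k *: x + y) = k *: amul z x + amul z y }.

#[short(type="fdAlgType")]
HB.structure Definition FinDimAlg (K : fieldType) :=
  {A of Vector K A & Vector_isUnitalAlg K A}.

Notation "x ** y" := (amul x y) (at level 40, left associativity) : ring_scope.

Section AlgebraTheory.
Variables (K : fieldType) (A : fdAlgType K).
Implicit Types x y z : A.

Lemma amulDl x y z : (x + y) ** z = x ** z + y ** z.
Proof. by have := amulPl 1 x y z; rewrite !scale1r. Qed.
Lemma amulDr x y z : z ** (x + y) = z ** x + z ** y.
Proof. by have := amulPr 1 x y z; rewrite !scale1r. Qed.
Lemma amul0l x : 0 ** x = 0.
Proof. by apply: (addrI (0 ** x)); rewrite -amulDl !addr0. Qed.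
Lemma amul0r x : x ** 0 = 0.
Proof. by apply: (addrI (x ** 0)); rewrite -amulDr !addr0. Qed.
Lemma amulZl k x y : (k *: x) ** y = k *: (x ** y).
Proof. by have := amulPl k x 0 y; rewrite amul0l !addr0. Qed.
Lemma amulZr k x y : y ** (k *: x) = k *: (y ** x).
Proof. by have := amulPr k x 0 y; rewrite amul0r !addr0. Qed.
Lemma amulBl x y z : (x - y) ** z = x ** z - y ** z.
Proof. by rewrite -!scaleN1r amulDl amulZl. Qed.
Lemma amulBr x y z : z ** (x - y) = z ** x - z ** y.
Proof. by rewrite -!scaleN1r amulDr amulZr. Qed.

End AlgebraTheory.

Section Algebras.
Variables (K : fieldType) (A : fdAlgType K).

Definition right_ideal (e : A) : {vspace A} :=
  vspan (fun y => exists x, y = e ** x).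

Lemma right_idealP e y : y \in right_ideal e <-> exists x, y = e ** x.
Proof.
apply: vspan_id => [|k _ _ [x ->] [y' ->]]; first by exists 0; rewrite amul0r.
by exists (k *: x + y'); rewrite amulPr.
Qed.

(* The space of right A-module homomorphisms from P to Q, for right ideals
   P and Q: vsproj P (vsval x ** a) is the element x a of P. *)
Definition hom_space (P Q : {vspace A}) :
    {vspace 'Hom(subvs_of P, subvs_of Q)} :=
  vspan (fun phi : 'Hom(subvs_of P, subvs_of Q) => forall x a,
    vsval (phi (vsproj P (vsval x ** a))) = vsval (phi x) ** a).

Lemma hom_spaceP e f (phi : 'Hom(_, _)) :
  phi \in hom_space (right_ideal e) (right_ideal f) <->
  forall x a, vsval (phi (vsproj (right_ideal e) (vsval x ** a)))
              = vsval (phi x) ** a.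
Proof.
apply: vspan_id => [x a|k f1 f2 h1 h2 x a]; first by rewrite !zero_lfunE amul0l.
by rewrite !add_lfunE !scale_lfunE !linearD !linearZ /= h1 h2 amulPl.
Qed.

(* The projective modules are the right modules e i A. *)
Definition cartan (I : Type) (e : I -> A) (i j : I) : nat :=
  \dim (hom_space (right_ideal (e i)) (right_ideal (e j))).

Record ideal := Ideal {
  ideal_space :> {vspace A};
  idealP : forall a b x, x \in ideal_space -> a ** x ** b \in ideal_space }.

Definition ideal_gen_space (R : A -> Prop) : {vspace A} :=
  vspan (fun x => exists a r b, R r /\ x = a ** r ** b).

Lemma ideal_genP R a b x :
  x \in ideal_gen_space R -> a ** x ** b \in ideal_gen_space R.
Proof.
set U := ideal_gen_space R => Ux.
suff : x \in vspan (fun y => a ** y ** b \in U).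
  apply: (iffLR (vspan_id _ _ _)); first by rewrite amul0r amul0l mem0v.
  move=> k y z Uy Uz; rewrite amulPr amulPl.
  by rewrite rpredD // rpredZ.
apply: (subvP (vspan_subvP _)) Ux => y [c [r [d [Rr ->]]]].
apply: mem_vspan; apply: mem_vspan.
by exists (a ** c), r, (d ** b); rewrite !amulA.
Qed.

Definition ideal_gen (R : A -> Prop) : ideal := Ideal (@ideal_genP R).

End Algebras.

(* The quotient by J is carried by a vector space complement of J, with the
   product transported along the projection quot_pi. *)
Definition quot_alg (K : fieldType) (A : fdAlgType K) (J : ideal A) : Type :=
  subvs_of (J^C)%VS.

Section Quotient.
Variables (K : fieldType) (A : fdAlgType K) (J : ideal A).
Local Notation B := (quot_alg J).
HB.instance Definition _ := Vector.copy B (subvs_of (J^C)%VS).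

Definition quot_pi (x : A) : B := vsproj (J^C)%VS (daddv_pi (J^C)%VS J x).
Definition quot_lift (x : B) : A := vsval (x : subvs_of (J^C)%VS).

Lemma quot_pi_is_linear : linear quot_pi.
Proof. by move=> k x y; rewrite /quot_pi !linearP. Qed.
HB.instance Definition _ := GRing.isSemilinear.Build K A B _ quot_pi
  (GRing.semilinear_linear quot_pi_is_linear).

Lemma quot_capC : (J^C :&: J = 0)%VS.
Proof. by rewrite capvC capv_compl. Qed.

Lemma quot_liftK : cancel quot_lift quot_pi.
Proof.
move=> x; rewrite /quot_pi /quot_lift daddv_pi_id ?vsvalK ?subvsP //.
exact: quot_capC.
Qed.

Lemma quot_lift_pi x : quot_lift (quot_pi x) - x \in (J : {vspace A}).
Proof.
rewrite /quot_pi /quot_lift vsprojK ?memv_pi //.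
have {2}-> : x = daddv_pi (J^C) J x + daddv_pi J (J^C) x.
  by rewrite daddv_pi_add ?quot_capC // addvC addv_complf memvf.
by rewrite opprD addNKr rpredN memv_pi.
Qed.

Lemma quot_pi_eq0 x : (quot_pi x == 0) = (x \in (J : {vspace A})).
Proof.
apply/eqP/idP => [px|Jx]; have := quot_lift_pi x.
  by rewrite px /quot_lift linear0 sub0r rpredN.
rewrite rpredBr // => Jl; rewrite -[LHS]quot_liftK.
suff -> : quot_lift (quot_pi x) = 0 by rewrite linear0.
apply/eqP; rewrite -memv0 -quot_capC memv_cap Jl andbT.
exact: subvsP.
Qed.

Lemma quot_pi_eq x y : (quot_pi x = quot_pi y) <-> x - y \in (J : {vspace A}).
Proof.
rewrite -quot_pi_eq0 linearB subr_eq0; split; last by move/eqP.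
by move=> e; apply/eqP.
Qed.

Lemma idealMl a x : x \in (J : {vspace A}) -> a ** x \in (J : {vspace A}).
Proof. by move=> Jx; rewrite -[_ ** _]amul1r idealP. Qed.
Lemma idealMr b x : x \in (J : {vspace A}) -> x ** b \in (J : {vspace A}).
Proof. by move=> Jx; rewrite -[x]amul1l idealP. Qed.

Definition quot_mul (x y : B) : B := quot_pi (quot_lift x ** quot_lift y).

Lemma quot_piM x y : quot_pi (x ** y) = quot_mul (quot_pi x) (quot_pi y).
Proof.
apply/esym/quot_pi_eq; set x' := quot_lift _; set y' := quot_lift _.
have -> : x' ** y' - x ** y = (x' - x) ** y' + x ** (y' - y).
  by rewrite amulBl amulBr addrA subrK.
by apply: rpredD; [apply: idealMr | apply: idealMl]; apply: quot_lift_pi.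
Qed.

Lemma quot_mulA : associative quot_mul.
Proof.
move=> x y z; rewrite -[x]quot_liftK -[y]quot_liftK -[z]quot_liftK.
by rewrite -!quot_piM amulA.
Qed.
Lemma quot_mul1l : left_id (quot_pi aone) quot_mul.
Proof. by move=> x; rewrite -[x]quot_liftK -quot_piM amul1l. Qed.
Lemma quot_mul1r : right_id (quot_pi aone) quot_mul.
Proof. by move=> x; rewrite -[x]quot_liftK -quot_piM amul1r. Qed.
Lemma quot_mulPl k x y z :
  quot_mul (k *: x + y) z = k *: quot_mul x z + quot_mul y z.
Proof.
rewrite -[x]quot_liftK -[y]quot_liftK -[z]quot_liftK.
move: (quot_lift x) (quot_lift y) (quot_lift z) => a b c.
have piP u w : k *: quot_pi u + quot_pi w = quot_pi (k *: u + w).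
  by rewrite linearP.
by rewrite piP -!quot_piM piP amulPl.
Qed.
Lemma quot_mulPr k x y z :
  quot_mul z (k *: x + y) = k *: quot_mul z x + quot_mul z y.
Proof.
rewrite -[x]quot_liftK -[y]quot_liftK -[z]quot_liftK.
move: (quot_lift x) (quot_lift y) (quot_lift z) => a b c.
have piP u w : k *: quot_pi u + quot_pi w = quot_pi (k *: u + w).
  by rewrite linearP.
by rewrite piP -!quot_piM piP amulPr.
Qed.
HB.instance Definition _ := Vector_isUnitalAlg.Build K B
  quot_mulA quot_mul1l quot_mul1r quot_mulPl quot_mulPr.

End Quotient.

Record idempotent (K : fieldType) (A : fdAlgType K) := Idempotent {
  idem_val :> A;
  idem_mul : idem_val ** idem_val = idem_val }.

Definition corner_space (K : fieldType) (A : fdAlgType K) (e : A) :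
  {vspace A} := vspan (fun y => exists x, y = e ** x ** e).

Definition corner (K : fieldType) (A : fdAlgType K) (e : idempotent A) : Type :=
  subvs_of (corner_space e).

Section Corner.
Variables (K : fieldType) (A : fdAlgType K) (e : idempotent A).
Local Notation B := (corner e).
HB.instance Definition _ := Vector.copy B (subvs_of (corner_space e)).

Lemma corner_spaceP y : y \in corner_space e <-> exists x, y = e ** x ** e.
Proof.
apply: vspan_id => [|k _ _ [x ->] [y' ->]].
  by exists 0; rewrite amul0r amul0l.
by exists (k *: x + y'); rewrite amulPr amulPl.
Qed.

Definition corner_val (x : B) : A := vsval (x : subvs_of (corner_space e)).

Lemma corner_valP x : corner_val x \in corner_space e.
Proof. exact: subvsP. Qed.

Lemma corner_val_inj : injective corner_val.
Proof. exact: val_inj. Qed.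

Lemma corner_el x : corner_val x = e ** corner_val x.
Proof.
by have /corner_spaceP[y ->] := corner_valP x; rewrite !amulA idem_mul.
Qed.
Lemma corner_er x : corner_val x = corner_val x ** e.
Proof.
by have /corner_spaceP[y ->] := corner_valP x; rewrite -!amulA idem_mul.
Qed.

Lemma corner_compress_subproof (x : A) : e ** x ** e \in corner_space e.
Proof. by apply/corner_spaceP; exists x. Qed.
Definition corner_compress (x : A) : B := Subvs (corner_compress_subproof x).

Definition corner_mul (x y : B) : B :=
  corner_compress (corner_val x ** corner_val y).
Definition corner_one : B := corner_compress aone.

Lemma corner_valM x y :
  corner_val (corner_mul x y) = corner_val x ** corner_val y.
Proof. by rewrite [LHS]/= amulA -corner_el -amulA -corner_er. Qed.
Lemma corner_val1 : corner_val corner_one = e.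
Proof. by rewrite [LHS]/= amul1r idem_mul. Qed.
Lemma corner_valP_linear k x y :
  corner_val (k *: x + y) = k *: corner_val x + corner_val y.
Proof. exact: (linearP (@vsval _ _ (corner_space e))). Qed.

Lemma corner_mulA : associative corner_mul.
Proof. by move=> x y z; apply: corner_val_inj; rewrite !corner_valM amulA. Qed.
Lemma corner_mul1l : left_id corner_one corner_mul.
Proof.
by move=> x; apply: corner_val_inj; rewrite corner_valM corner_val1 -corner_el.
Qed.
Lemma corner_mul1r : right_id corner_one corner_mul.
Proof.
by move=> x; apply: corner_val_inj; rewrite corner_valM corner_val1 -corner_er.
Qed.
Lemma corner_mulPl k x y z :
  corner_mul (k *: x + y) z = k *: corner_mul x z + corner_mul y z.
Proof.
apply: corner_val_inj.
by rewrite corner_valM !corner_valP_linear !corner_valM amulPl.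
Qed.
Lemma corner_mulPr k x y z :
  corner_mul z (k *: x + y) = k *: corner_mul z x + corner_mul z y.
Proof.
apply: corner_val_inj.
by rewrite corner_valM !corner_valP_linear !corner_valM amulPr.
Qed.
HB.instance Definition _ := Vector_isUnitalAlg.Build K B
  corner_mulA corner_mul1l corner_mul1r corner_mulPl corner_mulPr.

End Corner.

Section Walks.
Variables (V : eqType) (A : Type) (src tgt : A -> V).

Fixpoint walk (x : V) (w : seq A) : bool :=
  if w is a :: w' then (src a == x) && walk (tgt a) w' else true.
Definition walk_end (x : V) (w : seq A) : V := last x (map tgt w).
Definition acyclic := forall x w, walk x w -> walk_end x w = x -> w = [::].

Lemma walk_cat x w1 w2 :
  walk x (w1 ++ w2) = walk x w1 && walk (walk_end x w1) w2.
Proof. by elim: w1 x => //= a w1 IH x; rewrite IH andbA. Qed.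

Lemma walk_uniq x w : acyclic -> walk x w -> uniq (x :: map tgt w).
Proof.
move=> ac; elim: w x => //= a w IH x /andP[/eqP sa wa].
rewrite IH // andbT; apply/negP => xin.
have [w1 [w2 [b [e tb]]]] : exists w1 w2 b, a :: w = rcons w1 b ++ w2 /\ tgt b = x.
  move: xin; rewrite -[tgt a :: _]/(map tgt (a :: w)).
  elim: (a :: w) => //= c s IHs; rewrite inE => /orP[/eqP ->|/IHs].
    by exists [::], s, c.
  by move=> [w1 [w2 [b [-> tb]]]]; exists (c :: w1), w2, b.
have : walk x (a :: w) by rewrite /= sa eqxx.
rewrite e walk_cat => /andP[w1x _].
have := ac _ _ w1x; rewrite /walk_end map_rcons last_rcons => /(_ tb).
by case: (w1).
Qed.
End Walks.

Record quiver := Quiver {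
  vertex : finType;
  arrow : finType;
  src : arrow -> vertex;
  tgt : arrow -> vertex;
  quiver_acyclic : acyclic src tgt }.

Record qpath (Q : quiver) := QPath {
  qpath_val : vertex Q * seq (arrow Q);
  qpathP : walk (@src Q) (@tgt Q) qpath_val.1 qpath_val.2 }.

Section Paths.
Variable Q : quiver.

HB.instance Definition _ := [isSub for @qpath_val Q].
HB.instance Definition _ := [Countable of qpath Q by <:].

Definition pstart (p : qpath Q) : vertex Q := (qpath_val p).1.
Definition parrows (p : qpath Q) : seq (arrow Q) := (qpath_val p).2.
Definition pend (p : qpath Q) : vertex Q :=
  walk_end (@tgt Q) (pstart p) (parrows p).

Lemma size_parrows p : (size (parrows p) <= #|vertex Q|)%N.
Proof.
have /= /andP[_] := walk_uniq (quiver_acyclic (q := Q)) (qpathP p).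
by move=> /card_uniqP; rewrite size_map => <-; apply: max_card.
Qed.

Definition qpath_code (p : qpath Q) :
    vertex Q * #|vertex Q|.-bseq (arrow Q) :=
  (pstart p, Bseq (size_parrows p)).
Definition qpath_decode (c : vertex Q * #|vertex Q|.-bseq (arrow Q)) :
  option (qpath Q) := insub (c.1, val c.2).
Lemma qpath_codeK : pcancel qpath_code qpath_decode.
Proof.
move=> p; rewrite /qpath_decode /= -[X in insub X]surjective_pairing.
exact: valK.
Qed.
HB.instance Definition _ : isFinite (qpath Q) := PCanIsFinite qpath_codeK.

Definition ptriv (x : vertex Q) : qpath Q := @QPath Q (x, [::]) isT.

(* r = p q; paths are composed from left to right. *)
Definition pcomp (p q r : qpath Q) : bool :=
  [&& pstart r == pstart p, pstart q == pend p
    & parrows r == parrows p ++ parrows q].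

Lemma qpath_inj p q : pstart p = pstart q -> parrows p = parrows q -> p = q.
Proof.
rewrite /pstart /parrows => e1 e2; apply: val_inj => /=.
by rewrite [qpath_val p]surjective_pairing e1 e2 -surjective_pairing.
Qed.

Lemma pcomp_ex p q : pstart q = pend p -> exists r, pcomp p q r.
Proof.
move=> e.
have h : walk (@src Q) (@tgt Q) (pstart p) (parrows p ++ parrows q).
  rewrite walk_cat; apply/andP; split; first exact: qpathP.
  by rewrite -/(pend p) -e; apply: qpathP.
by exists (@QPath Q (pstart p, parrows p ++ parrows q) h);
  rewrite /pcomp e !eqxx.
Qed.

Lemma pcomp_uniq p q r r' : pcomp p q r -> pcomp p q r' -> r = r'.
Proof.
move=> /and3P[/eqP s1 _ /eqP a1] /and3P[/eqP s2 _ /eqP a2].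
by apply: qpath_inj; rewrite ?s1 ?s2 ?a1 ?a2.
Qed.

Lemma pcomp_end p q r : pcomp p q r -> pend r = pend q.
Proof.
move=> /and3P[/eqP s1 /eqP s2 /eqP a1].
by rewrite /pend /walk_end s1 a1 map_cat last_cat s2.
Qed.

End Paths.

Definition path_alg (K : fieldType) (Q : quiver) : Type :=
  {ffun qpath Q -> K^o}.

Section PathAlg.
Variables (K : fieldType) (Q : quiver).
Local Notation KQ := (path_alg K Q).
HB.instance Definition _ := Vector.copy KQ {ffun qpath Q -> K^o}.

Definition pcoef (f : KQ) (p : qpath Q) : K := (f : {ffun qpath Q -> K^o}) p.
Definition pelt (p : qpath Q) : KQ := [ffun q : qpath Q => (q == p)%:R].

Definition pmul (f g : KQ) : KQ :=
  [ffun r => \sum_p \sum_(q | pcomp p q r) pcoef f p * pcoef g q].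
Definition pone : KQ := [ffun p : qpath Q => (parrows p == [::])%:R].

Lemma path_algP (f g : KQ) : (forall p, pcoef f p = pcoef g p) -> f = g.
Proof. by move=> h; apply/ffunP => p; apply: h. Qed.

Lemma pcoefD f g p : pcoef (f + g) p = pcoef f p + pcoef g p.
Proof. by rewrite /pcoef ffunE. Qed.
Lemma pcoefZ k f p : pcoef (k *: f) p = k * pcoef f p.
Proof. by rewrite /pcoef ffunE. Qed.
Lemma pcoefM f g r : pcoef (pmul f g) r =
  \sum_p \sum_q pcoef f p * pcoef g q * (pcomp p q r)%:R.
Proof.
rewrite /pcoef ffunE; apply: eq_bigr => p _; rewrite big_mkcond.
by apply: eq_bigr => q _; case: ifP; rewrite ?mulr1 ?mulr0.
Qed.

Lemma pcomp_sum3l (p q w r : qpath Q) : \sum_u (pcomp p q u && pcomp u w r)%:R =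
  [&& pstart r == pstart p, pstart q == pend p, pstart w == pend q
    & parrows r == parrows p ++ parrows q ++ parrows w]%:R :> K.
Proof.
have [sq|nsq] := eqVneq (pstart q) (pend p); last first.
  rewrite big1 ?andbF // => u _.
  by rewrite {1}/pcomp (negPf nsq) andbF.
have [t pqt] := pcomp_ex sq.
rewrite (bigD1 t) //= big1 ?addr0 => [|u /negP ut]; last first.
  by case: (boolP (pcomp p q u)) => // /(pcomp_uniq pqt) e; case: ut; rewrite e.
rewrite pqt /= {1}/pcomp (pcomp_end pqt).
by case/and3P: pqt => /eqP -> _ /eqP ->; rewrite -catA.
Qed.

Lemma pcomp_sum3r (p q w r : qpath Q) : \sum_u (pcomp q w u && pcomp p u r)%:R =
  [&& pstart r == pstart p, pstart q == pend p, pstart w == pend q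
    & parrows r == parrows p ++ parrows q ++ parrows w]%:R :> K.
Proof.
have [sw|nsw] := eqVneq (pstart w) (pend q); last first.
  rewrite big1 ?andbF // => u _.
  by rewrite {1}/pcomp (negPf nsw) andbF.
have [t qwt] := pcomp_ex sw.
rewrite (bigD1 t) //= big1 ?addr0 => [|u /negP ut]; last first.
  by case: (boolP (pcomp q w u)) => // /(pcomp_uniq qwt) e; case: ut; rewrite e.
rewrite qwt /= {1}/pcomp.
by case/and3P: qwt => /eqP -> _ /eqP ->.
Qed.

Lemma pmulA : associative pmul.
Proof.
move=> f g h; apply: path_algP => r; rewrite !pcoefM; symmetry.
transitivity (\sum_p \sum_q \sum_w pcoef f p * pcoef g q * pcoef h w *
    (\sum_u (pcomp p q u && pcomp u w r)%:R)).
  transitivity (\sum_u \sum_p \sum_q \sum_w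
      pcoef f p * pcoef g q * pcoef h w * (pcomp p q u && pcomp u w r)%:R).
    apply: eq_bigr => u _; rewrite pcoefM.
    transitivity (\sum_w \sum_p \sum_q
      pcoef f p * pcoef g q * pcoef h w * (pcomp p q u && pcomp u w r)%:R).
      apply: eq_bigr => w _; rewrite !mulr_suml; apply: eq_bigr => p _.
      rewrite !mulr_suml; apply: eq_bigr => q _.
      by rewrite -mulnb natrM mulrA; congr (_ * _); rewrite mulrAC.
    rewrite exchange_big; apply: eq_bigr => p _.
    by rewrite exchange_big.
  rewrite exchange_big; apply: eq_bigr => p _ /=.
  rewrite exchange_big; apply: eq_bigr => q _ /=.
  rewrite exchange_big; apply: eq_bigr => w _ /=.
  by rewrite mulr_sumr.
apply: eq_bigr => p _.
transitivity (\sum_q \sum_w pcoef f p * pcoef g q * pcoef h w *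
    (\sum_u (pcomp q w u && pcomp p u r)%:R)).
  by apply: eq_bigr => q _; apply: eq_bigr => w _;
    rewrite pcomp_sum3l pcomp_sum3r.
transitivity (\sum_u \sum_q \sum_w
    pcoef f p * pcoef g q * pcoef h w * (pcomp q w u && pcomp p u r)%:R).
  symmetry; rewrite exchange_big; apply: eq_bigr => q _ /=.
  rewrite exchange_big; apply: eq_bigr => w _ /=.
  by rewrite mulr_sumr.
apply: eq_bigr => u _; rewrite pcoefM mulr_sumr mulr_suml.
apply: eq_bigr => q _; rewrite mulr_sumr mulr_suml; apply: eq_bigr => w _.
by rewrite -mulnb natrM !mulrA.
Qed.

Lemma pmul1 : left_id pone pmul.
Proof.
move=> f; apply: path_algP => r; rewrite pcoefM.
rewrite (bigD1 (ptriv (pstart r))) //= [X in _ + X]big1 ?addr0 => [|p np].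
  rewrite (bigD1 r) //= big1 ?addr0 => [|q nq].
    by rewrite /pcoef /pone ffunE /pcomp /= /pend /walk_end /= !eqxx mul1r mulr1.
  case: (boolP (pcomp _ _ _)) => [/and3P[_ /eqP sq /eqP aq]|_]; last first.
    by rewrite mulr0.
  by case/eqP: nq; apply: qpath_inj.
apply: big1 => q _; rewrite {1}/pcoef /pone ffunE.
have [p0|] := eqVneq (parrows p) [::]; last by rewrite !mul0r.
case: (boolP (pcomp _ _ _)) => [/and3P[/eqP sr _ _]|_]; last by rewrite mulr0.
by case/eqP: np; apply: qpath_inj.
Qed.

Lemma pmulr1 : right_id pone pmul.
Proof.
move=> f; apply: path_algP => r; rewrite pcoefM.
rewrite (bigD1 r) //= [X in _ + X]big1 ?addr0 => [|p np].
  rewrite (bigD1 (ptriv (pend r))) //= big1 ?addr0 => [|q nq].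
    by rewrite /pcoef /pone ffunE /pcomp /= cats0 !eqxx !mulr1.
  rewrite {2}/pcoef /pone ffunE.
  have [q0|] := eqVneq (parrows q) [::]; last by rewrite mulr0 mul0r.
  case: (boolP (pcomp _ _ _)) => [/and3P[_ /eqP sq _]|_]; last by rewrite mulr0.
  by case/eqP: nq; apply: qpath_inj.
apply: big1 => q _; rewrite {2}/pcoef /pone ffunE.
have [q0|] := eqVneq (parrows q) [::]; last by rewrite mulr0 mul0r.
case: (boolP (pcomp _ _ _)) => [/and3P[/eqP sr _ /eqP]|_]; last by rewrite mulr0.
by rewrite q0 cats0 => ar; case/eqP: np; apply: qpath_inj.
Qed.

Lemma pmulPl k f g h : pmul (k *: f + g) h = k *: pmul f h + pmul g h.
Proof.
apply: path_algP => r; rewrite pcoefD pcoefZ !pcoefM mulr_sumr -big_split.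
apply: eq_bigr => p _; rewrite mulr_sumr -big_split; apply: eq_bigr => q _ /=.
by rewrite pcoefD pcoefZ !mulrDl !mulrA.
Qed.

Lemma pmulPr k f g h : pmul h (k *: f + g) = k *: pmul h f + pmul h g.
Proof.
apply: path_algP => r; rewrite pcoefD pcoefZ !pcoefM mulr_sumr -big_split.
apply: eq_bigr => p _; rewrite mulr_sumr -big_split; apply: eq_bigr => q _ /=.
by rewrite pcoefD pcoefZ mulrDr mulrDl !mulrA [k * _]mulrC.
Qed.

HB.instance Definition _ := Vector_isUnitalAlg.Build K KQ
  pmulA pmul1 pmulr1 pmulPl pmulPr.

Lemma peltM p q r : pcomp p q r -> pelt p ** pelt q = pelt r.
Proof.
move=> pqr; apply: path_algP => s; rewrite [LHS]pcoefM.
rewrite (bigD1 p) //= [X in _ + X]big1 ?addr0 => [|p' np]; last first.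
  by apply: big1 => q' _; rewrite {1}/pcoef ffunE (negPf np) !mul0r.
rewrite (bigD1 q) //= [X in _ + X]big1 ?addr0 => [|q' nq]; last first.
  by rewrite {2}/pcoef ffunE (negPf nq) mulr0 mul0r.
rewrite /pcoef !ffunE !eqxx !mul1r; congr (_%:R); congr nat_of_bool.
by apply/idP/eqP => [/(pcomp_uniq pqr)|->].
Qed.

Lemma peltM0 p q : pend p != pstart q -> pelt p ** pelt q = 0.
Proof.
move=> npq; apply: path_algP => s; rewrite [LHS]pcoefM /pcoef ffunE.
apply: big1 => p' _; apply: big1 => q' _; rewrite !ffunE.
have [->|_] := eqVneq p' p; last by rewrite !mul0r.
have [->|_] := eqVneq q' q; last by rewrite mulr0 mul0r.
by rewrite /pcomp eq_sym [pstart q == _]eq_sym (negPf npq) /= andbF mulr0.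
Qed.

Definition parallel_comb (u w : vertex Q) (f : KQ) : Prop :=
  forall p, pcoef f p != 0 -> pstart p = u /\ pend p = w.

End PathAlg.

Record bquiver (K : fieldType) := BQuiver {
  bq_quiver : quiver;
  bq_ideal : ideal (path_alg K bq_quiver) }.

Section BoundQuiver.
Variables (K : fieldType) (L : bquiver K).
Local Notation Q := (bq_quiver L).

Definition is_triangular : Prop :=
  exists R : path_alg K Q -> Prop,
    (forall r, R r -> (exists u w, parallel_comb u w r) /\
       forall p, pcoef r p != 0 -> (2 <= size (parrows p))%N)
    /\ (bq_ideal L : {vspace _}) = ideal_gen R.

Definition bq_alg : fdAlgType K := quot_alg (bq_ideal L).

Lemma bq_idem_subproof (x : vertex Q) :
  let e : bq_alg := quot_pi (bq_ideal L) (pelt K (ptriv x)) in e ** e = e.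
Proof.
rewrite /= -[LHS]quot_piM (@peltM _ _ _ _ (ptriv x)) //.
by rewrite /pcomp !eqxx.
Qed.
Definition bq_idem (x : vertex Q) : idempotent bq_alg :=
  Idempotent (bq_idem_subproof x).

Lemma bq_coidem_subproof (x : vertex Q) :
  let f := aone - (bq_idem x : bq_alg) in f ** f = f.
Proof.
by rewrite /= amulBl amul1l amulBr amul1r bq_idem_subproof subrr subr0.
Qed.
Definition bq_coidem (x : vertex Q) : idempotent bq_alg :=
  Idempotent (bq_coidem_subproof x).

Definition coxeter : {poly int} :=
  coxeter_poly (cartan (fun x : vertex Q => bq_idem x : bq_alg)).

(* The primitive idempotents of (1 - e_v) A (1 - e_v) are the e_x for x != v,
   compressed here to the corner algebra. *)
Definition coxeter_corner (v : vertex Q) : {poly int} :=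
  coxeter_poly (cartan (fun x : {x : vertex Q | x != v} =>
    corner_compress (bq_coidem v) (bq_idem (val x)))).

End BoundQuiver.

Section Posets.
Variables (d : Order.disp_t) (S : finPOrderType d).

Definition coxeter_poset : {poly int} :=
  coxeter_poly (fun s t : S => (t <= s)%O : nat).

Definition minimal (s : S) : bool := [forall t : S, ~~ (t < s)%O].
Definition maximal (s : S) : bool := [forall t : S, ~~ (s < t)%O].
Definition covered (s t : S) : bool :=
  (s < t)%O && [forall u : S, ~~ ((s < u)%O && (u < t)%O)].

Definition hasse_arrow := {a : S * S | covered a.1 a.2}.

Lemma hasse_walk_lt s (w : seq hasse_arrow) :
  walk (fun a => (val a).1) (fun a => (val a).2) s w -> w != [::] ->
  (s < walk_end (fun a => (val a).2) s w)%O.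
Proof.
elim: w s => //= a w IH s /andP[/eqP <- ww] _.
have /andP[lt_a _] := valP a.
case: w IH ww => [//|b w] IH ww.
exact: (lt_trans lt_a (IH _ ww isT)).
Qed.

Lemma hasse_acyclic :
  acyclic (fun a : hasse_arrow => (val a).1) (fun a => (val a).2).
Proof.
move=> s w ww e; apply/eqP/negPn/negP => /(hasse_walk_lt ww).
by rewrite e ltxx.
Qed.

Definition hasse : quiver := Quiver hasse_acyclic.

(* S with a new top element None *)
Definition hat : Type := option S.
HB.instance Definition _ := Finite.copy hat (option S).

Definition hat_le (x y : hat) : bool :=
  match x, y with
  | _, None => true
  | None, Some _ => false
  | Some s, Some t => (s <= t)%O
  end.
Lemma hat_le_refl : reflexive hat_le.
Proof. by case=> [s|] //=. Qed.
Lemma hat_le_anti : antisymmetric hat_le.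
Proof. by move=> [s|] [t|] //= /le_anti ->. Qed.
Lemma hat_le_trans : transitive hat_le.
Proof. by move=> [s|] [t|] [u|] //=; apply: le_trans. Qed.
HB.instance Definition _ :=
  Order.Le_isPOrder.Build d hat hat_le_refl hat_le_anti hat_le_trans.

End Posets.

Section Insertion.
Variables (K : fieldType) (L : bquiver K) (v : vertex (bq_quiver L)).
Variables (d : Order.disp_t) (S : finPOrderType d).
Local Notation Q := (bq_quiver L).
Local Notation QS := (hasse S).

(* Raw vertices and arrows; the vertices and arrows of the new quiver are the
   ones selected by the predicates below. *)
Definition raw_vertex : finType := (vertex Q + S)%type.
Definition raw_arrow : finType :=
  ((arrow Q + arrow QS) + (arrow Q * S + S * arrow Q))%type.

Definition old (g : arrow Q) : raw_arrow := inl (inl g).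
Definition inner (a : arrow QS) : raw_arrow := inl (inr a).
Definition into (a : arrow Q) (s : S) : raw_arrow := inr (inl (a, s)).
Definition outof (s : S) (b : arrow Q) : raw_arrow := inr (inr (s, b)).

Definition raw_src (r : raw_arrow) : raw_vertex :=
  match r with
  | inl (inl g) => inl (src g)
  | inl (inr a) => inr (src a)
  | inr (inl (a, s)) => inl (src a)
  | inr (inr (s, b)) => inr s
  end.
Definition raw_tgt (r : raw_arrow) : raw_vertex :=
  match r with
  | inl (inl g) => inl (tgt g)
  | inl (inr a) => inr (tgt a)
  | inr (inl (a, s)) => inr s
  | inr (inr (s, b)) => inl (tgt b)
  end.

Definition ins_vertex_pred (x : raw_vertex) : bool := x != inl v.
Definition ins_arrow_pred (r : raw_arrow) : bool :=
  match r with
  | inl (inl g) => (src g != v) && (tgt g != v)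
  | inl (inr a) => true
  | inr (inl (a, s)) => (tgt a == v) && minimal s
  | inr (inr (s, b)) => (src b == v) && maximal s
  end.

Definition ins_vertex := {x : raw_vertex | ins_vertex_pred x}.
Definition ins_arrow := {r : raw_arrow | ins_arrow_pred r}.

Lemma no_loop (a : arrow Q) : src a != tgt a.
Proof.
apply/eqP => e; have := quiver_acyclic (x := src a) (w := [:: a]).
by rewrite /= eqxx /walk_end /= => /(_ isT (esym e)).
Qed.

Lemma ins_srcP (r : ins_arrow) : ins_vertex_pred (raw_src (val r)).
Proof.
case: r => [[[g|a]|[[a s]|[s b]]]] //= /andP[]; rewrite /ins_vertex_pred //.
by move=> /eqP <- _; have := no_loop a; apply: contra => /eqP[->].
Qed.
Lemma ins_tgtP (r : ins_arrow) : ins_vertex_pred (raw_tgt (val r)).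
Proof.
case: r => [[[g|a]|[[a s]|[s b]]]] //= /andP[]; rewrite /ins_vertex_pred //.
by move=> /eqP <- _; have := no_loop b; apply: contra => /eqP[->].
Qed.
Definition ins_src (r : ins_arrow) : ins_vertex := Sub _ (ins_srcP r).
Definition ins_tgt (r : ins_arrow) : ins_vertex := Sub _ (ins_tgtP r).

Definition collapse (x : ins_vertex) : vertex Q :=
  if val x is inl y then y else v.
Definition collapse_arrow (r : ins_arrow) : seq (arrow Q) :=
  match val r with
  | inl (inl g) => [:: g]
  | inl (inr a) => [::]
  | inr (inl (a, s)) => [:: a]
  | inr (inr (s, b)) => [:: b]
  end.

Lemma collapse_walk x w : walk ins_src ins_tgt x w ->
  let cw := flatten (map collapse_arrow w) in
  walk (@src Q) (@tgt Q) (collapse x) cw /\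
  walk_end (@tgt Q) (collapse x) cw = collapse (walk_end ins_tgt x w).
Proof.
elim: w x => //= r w IH x /andP[/eqP <- /IH[]].
rewrite /walk_end /=.
case: r => [[[g|a]|[[a s]|[s b]]]] /= h; rewrite /collapse /collapse_arrow /=;
  rewrite ?eqxx //.
- by have /andP[/eqP -> _] := h.
- by have /andP[/eqP -> _] := h; rewrite eqxx.
Qed.

Lemma inner_walk_lt x w : walk ins_src ins_tgt x w -> w != [::] ->
  flatten (map collapse_arrow w) = [::] ->
  exists s t, [/\ val x = inr s, val (walk_end ins_tgt x w) = inr t
    & (s < t)%O].
Proof.
elim: w x => //= r w IH x /andP[/eqP <- ww] _.
case: r ww => [[[g|a]|[[a s]|[s b]]]] h ww //= e.
have /andP[lt_a _] := valP a.
case: w IH ww e => [|r w] IH ww e.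
  by exists (src a), (tgt a).
have [s [t [/= [<-] et lt_t]]] := IH _ ww isT e.
exists (src a), t; split=> //.
exact: lt_trans lt_a lt_t.
Qed.

Lemma ins_acyclic : acyclic ins_src ins_tgt.
Proof.
move=> x w ww e; apply/eqP/negPn/negP => w0.
have [cw ce] := collapse_walk ww.
have /(inner_walk_lt ww w0) := quiver_acyclic cw (etrans ce (congr1 _ e)).
move=> [s [t [es]]]; rewrite e es => -[<-].
by rewrite ltxx.
Qed.

Definition ins_quiver : quiver := Quiver ins_acyclic.
Local Notation KQ' := (path_alg K ins_quiver).

(* The path with start x and sequence of arrows w, as an element of the path
   algebra; 0 if there is no such path. *)
Definition word (x : raw_vertex) (w : seq raw_arrow) : KQ' :=
  [ffun p : qpath ins_quiver =>
     ((val (pstart p) == x) && (map val (parrows p) == w))%:R].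

Definition extend (phi : qpath Q -> KQ') (x : path_alg K Q) : KQ' :=
  \sum_p pcoef x p *: phi p.

(* (p, s) and (s, p); only paths of length at least 2 matter below, and the
   values on trivial paths are irrelevant. *)
Definition path_into (s : S) (p : qpath Q) : KQ' :=
  word (inl (pstart p))
    (if parrows p is a :: w then
       rcons (map old (belast a w)) (into (last a w) s) else [::]).
Definition path_outof (s : S) (p : qpath Q) : KQ' :=
  word (inr s)
    (if parrows p is b :: w then outof s b :: map old w else [::]).

Definition inner_word (q : qpath QS) : seq raw_arrow := map inner (parrows q).

(* If arrows a, b of p meet at v, they are replaced by (a, s) q (t, b), where s
   and t are the start and the end of q; a path avoiding v is unchanged. *)
Definition path_through (q : qpath QS) (p : qpath Q) : KQ' :=
  word (inl (pstart p)) (flatten [seq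
    (if tgt a == v then into a (pstart q) :: inner_word q
     else if src a == v then [:: outof (pend q) a]
     else [:: old a]) | a <- parrows p]).

Inductive ins_rel : KQ' -> Prop :=
| Rel1a (s : S) u x of minimal s & x \in (bq_ideal L : {vspace _})
    & parallel_comb u v x :
    ins_rel (extend (path_into s) x)
| Rel1b (s : S) w x of maximal s & x \in (bq_ideal L : {vspace _})
    & parallel_comb v w x :
    ins_rel (extend (path_outof s) x)
| Rel2a (q q' : qpath QS) of pstart q = pstart q' & pend q = pend q' :
    ins_rel (word (inr (pstart q)) (inner_word q)
           - word (inr (pstart q')) (inner_word q'))
| Rel2b (a : arrow Q) (q q' : qpath QS) of tgt a = v
    & minimal (pstart q : S) & minimal (pstart q' : S) & pend q = pend q' :
    ins_rel (word (inl (src a)) (into a (pstart q) :: inner_word q)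
           - word (inl (src a)) (into a (pstart q') :: inner_word q'))
| Rel2c (b : arrow Q) (q q' : qpath QS) of src b = v
    & maximal (pend q : S) & maximal (pend q' : S) & pstart q = pstart q' :
    ins_rel (word (inr (pstart q)) (rcons (inner_word q) (outof (pend q) b))
           - word (inr (pstart q')) (rcons (inner_word q') (outof (pend q') b)))
| Rel2d (a b : arrow Q) (q q' : qpath QS) of tgt a = v & src b = v
    & minimal (pstart q : S) & minimal (pstart q' : S)
    & maximal (pend q : S) & maximal (pend q' : S) :
    ins_rel
      (word (inl (src a))
         (into a (pstart q) :: rcons (inner_word q) (outof (pend q) b))
     - word (inl (src a))
         (into a (pstart q') :: rcons (inner_word q') (outof (pend q') b)))
(* the path q in S is chosen separately for each p *)
| Rel3 u w x (c : qpath Q -> qpath QS) of u != v & w != v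
    & x \in (bq_ideal L : {vspace _}) & parallel_comb u w x
    & (forall p, minimal (pstart (c p) : S) /\ maximal (pend (c p) : S)) :
    ins_rel (extend (fun p => path_through (c p) p) x).

Definition insertion : bquiver K := BQuiver (ideal_gen ins_rel).

End Insertion.

(* Main.v *)
Require Import Defs.
From HB Require Import structures.
From mathcomp Require Import all_boot all_order all_algebra perm.

Set Implicit Arguments.
Unset Strict Implicit.
Unset Printing Implicit Defensive.

Import Order.TTheory GRing.Theory.
Local Open Scope ring_scope.

(** Write [L] for the given algebra and [T] for the poset [S] with a top element
    added.  All Coxeter polynomials here are determinants of matrices
    [x C + C^T], so two things are needed: the Cartan matrix of the insertion,
    and a determinant identity.

    _The Cartan matrix._  The entry at [i, j] is the dimension of [e_j A e_i],
    that is, of the space of combinations of paths from [j] to [i] modulo the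
    ideal ([dim_hom_right_ideal], [cartan_bq]).  Contracting the inserted poset
    to the vertex [v] is a linear map from the path algebra of the new quiver to
    the old one, multiplicative on composable paths.  It sends the new ideal to
    the old one, since it does so on every relation ([contraction_ideal]).
    Conversely, a path of the old quiver lifts to the new one once a path [q] of
    the Hasse quiver is chosen for its passage through [v]; there is at most one
    passage since there are no oriented cycles.  The commutativity relations say
    that the choice of [q] does not matter ([lifted_cong]), every path of the new
    quiver is such a lift ([raw_ok_lift]), and the remaining relations say that
    lifting sends the old ideal to the new one ([lifted_ideal]).  Hence
    contraction identifies [e_y A' e_x] with the space between the images of [x]
    and [y], as soon as some [q] fits the two ends.  The only pairs without a
    fitting [q] are the pairs of poset elements with no relation from [x] to [y],
    between which there is no path at all.  So the Cartan matrix of the insertion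
    is the one of [L] with the row and column of [v] repeated for every element
    of [T], and with the Cartan matrix of [T] on the diagonal block of [T]
    ([cartan_insertion]).

    _The determinant._  Order the new vertices as [S], the top element, the old
    vertices other than [v].  Subtracting the row of the top element from the
    rows of [S], and likewise for the columns, clears the blocks that link [S] to
    the old vertices ([det_block_shear]).  The row of the top element is then the
    sum of its part on [T] and its part on the vertices of [L], minus the diagonal
    entry [x + 1], which both parts contain.  The determinant is linear in this
    row and each of the three terms is block triangular: they give the three
    products in the formula ([det_amalgam]).  The algebra [(1 - e_v) L (1 - e_v)]
    enters through the minor of [L] without [v] ([cartan_corner]). *)

(** * Dimensions of spaces of homomorphisms *)

Lemma linear_hom (K : fieldType) (U V : vectType K) (f : U -> V) :
  linear f -> {g : 'Hom(U, V) | forall x, g x = f x}.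
Proof.
move=> f_lin.
pose F : {linear U -> V} :=
  HB.pack f (GRing.isSemilinear.Build K U V _ f (GRing.semilinear_linear f_lin)).
by exists (linfun F) => x; rewrite lfunE.
Qed.

Lemma dim_limg_transfer (K : fieldType) (V1 V2 W1 W2 : vectType K)
    (g1 : 'Hom(V1, W1)) (g2 : 'Hom(V2, W2)) (F : 'Hom(V1, V2))
    (U : {vspace V1}) :
  (forall x, x \in U -> (g1 x == 0) = (g2 (F x) == 0)) ->
  \dim (g1 @: U) = \dim (g2 @: (F @: U)).
Proof.
move=> ker_eq; rewrite -limg_comp.
apply/eqP; rewrite -(eqn_add2l (\dim (U :&: lker g1))) limg_ker_dim.
suff -> : (U :&: lker g1 = U :&: lker (g2 \o F))%VS by rewrite limg_ker_dim.
apply/vspaceP => x; rewrite !memv_cap !memv_ker comp_lfunE.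
by case Ux: (x \in U) => //=; apply: ker_eq.
Qed.

Section Peirce.
Variables (K : fieldType) (A : fdAlgType K).

Definition peirce (f e : A) : {vspace A} :=
  vspan (fun y => exists x, y = f ** x ** e).

Lemma peirceP f e y : y \in peirce f e <-> exists x, y = f ** x ** e.
Proof.
apply: vspan_id => [|k _ _ [x ->] [y' ->]].
  by exists 0; rewrite amul0r amul0l.
by exists (k *: x + y'); rewrite amulPr amulPl.
Qed.

(** A homomorphism from [e A] is determined by the image of [e], which can be
    any element of [f A e]: evaluation at [e] is an isomorphism. *)
Lemma dim_hom_right_ideal e f : e ** e = e -> f ** f = f ->
  \dim (hom_space (right_ideal e) (right_ideal f)) = \dim (peirce f e).
Proof.
move=> ee ff.
pose P := right_ideal e; pose R := right_ideal f.
pose ev (phi : 'Hom(subvs_of P, subvs_of R)) : A := vsval (phi (vsproj P e)).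
have ev_lin : linear ev.
  by move=> k phi psi; rewrite /ev add_lfunE scale_lfunE linearP.
have [EV evE] := linear_hom ev_lin.
have Pe : e \in P by apply/right_idealP; exists e; rewrite ee.
have evP phi x : phi \in hom_space P R -> vsval (phi x) = ev phi ** vsval x.
  move=> /hom_spaceP hphi; rewrite /ev -hphi vsprojK //.
  suff -> : e ** vsval x = vsval x by rewrite vsvalK.
  by have /right_idealP[y ->] := subvsP x; rewrite amulA ee.
rewrite -(@limg_dim_eq _ _ _ (EV)); last first.
  apply/eqP; rewrite -subv0; apply/subvP => phi.
  rewrite memv_cap memv_ker evE memv0 => /andP[hphi /eqP ev0].
  apply/eqP/lfunP => x; apply: val_inj.
  by rewrite [LHS](evP _ _ hphi) ev0 amul0l zero_lfunE.
congr (\dim _); apply/vspaceP => y; apply/idP/idP.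
  case/memv_imgP => phi hphi ->; rewrite evE; apply/peirceP.
  have /right_idealP[x ex] := subvsP (phi (vsproj P e)).
  exists x; rewrite -ex -[LHS]/(ev phi).
  by have := evP phi (vsproj P e) hphi; rewrite vsprojK.
case/peirceP => x ey.
have Ry z : y ** z \in R.
  by apply/right_idealP; exists (x ** e ** z); rewrite ey !amulA.
pose m (u : subvs_of P) : subvs_of R := vsproj R (y ** vsval u).
have m_lin : linear m.
  by move=> k u w; rewrite /m linearP amulPr linearP.
have [M mE] := linear_hom m_lin.
apply/memv_imgP; exists M.
  apply/hom_spaceP => u a; rewrite !mE /m (vsprojK (x := vsval u ** a)).
    by rewrite !(vsprojK (Ry _)) amulA.
  have /right_idealP[z ->] := subvsP u.
  by apply/right_idealP; exists (z ** a); rewrite amulA.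
rewrite evE /ev mE /m !vsprojK //.
by rewrite ey -[RHS]amulA ee.
Qed.

Lemma cartanE (I : Type) (e : I -> A) i j :
  e i ** e i = e i -> e j ** e j = e j ->
  cartan e i j = \dim (peirce (e j) (e i)).
Proof. exact: dim_hom_right_ideal. Qed.

End Peirce.

(** Compressing [e <= c] and [f <= c] to the corner algebra [c A c] does not
    change the space between them, because [f (c x c) e = f x e]. *)
Lemma dim_peirce_corner (K : fieldType) (A : fdAlgType K) (c : Defs.idempotent A)
    (f e : A) : f ** c = f -> c ** f = f -> e ** c = e -> c ** e = e ->
  \dim (peirce (corner_compress c f) (corner_compress c e))
    = \dim (peirce f e).
Proof.
move=> fc cf ec ce.
have [iota iotaE] : {g : 'Hom(corner c, A) | forall x, g x = corner_val x}.
  by apply: linear_hom => k x y; apply: corner_valP_linear.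
have valc z : c ** z = z -> z ** c = z -> corner_val (corner_compress c z) = z.
  by move=> cz zc; rewrite [LHS]/= cz zc.
rewrite -(@limg_dim_eq _ _ _ iota); last first.
  apply/eqP; rewrite -subv0; apply/subvP => x.
  rewrite memv_cap memv_ker iotaE memv0 => /andP[_ /eqP x0].
  by apply/eqP/val_inj; rewrite [LHS]x0.
congr (\dim _); apply/vspaceP => y; apply/idP/idP.
  case/memv_imgP => x /peirceP[z ->] ->; rewrite iotaE; apply/peirceP.
  by exists (corner_val z); rewrite !corner_valM !valc.
case/peirceP => x ->; apply/memv_imgP.
exists (corner_compress c f ** corner_compress c x ** corner_compress c e).
  by apply/peirceP; exists (corner_compress c x).
have -> : iota (corner_compress c f ** corner_compress c x ** corner_compress c e)
    = f ** (c ** x ** c) ** e.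
  by rewrite iotaE !corner_valM (valc f) // (valc e).
by rewrite !amulA fc -!amulA ce.
Qed.

(** * Spaces of parallel paths *)

Lemma loop_trivial (Q : quiver) (p : qpath Q) :
  pstart p = pend p -> parrows p = [::].
Proof. by move=> e; apply: (quiver_acyclic (qpathP p)); rewrite [RHS]e. Qed.

Section ParallelPaths.
Variables (K : fieldType) (Q : quiver).
Local Notation KQ := (path_alg K Q).
Implicit Types (p q : qpath Q) (f : KQ).

Definition path_lin (V : lmodType K) (g : qpath Q -> V) f : V :=
  \sum_p pcoef f p *: g p.

Lemma path_lin_is_linear (V : lmodType K) (g : qpath Q -> V) :
  linear (path_lin g).
Proof.
move=> k f h; rewrite /path_lin scaler_sumr -big_split; apply: eq_bigr => p _.
by rewrite pcoefD pcoefZ scalerDl scalerA.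
Qed.
HB.instance Definition _ (V : lmodType K) (g : qpath Q -> V) :=
  GRing.isSemilinear.Build K KQ V _ (path_lin g)
    (GRing.semilinear_linear (path_lin_is_linear g)).

Lemma pcoef_pelt p q : pcoef (pelt K p) q = (q == p)%:R.
Proof. by rewrite /pcoef ffunE. Qed.

Lemma path_lin_pelt (V : lmodType K) (g : qpath Q -> V) p :
  path_lin g (pelt K p) = g p.
Proof.
rewrite /path_lin (bigD1 p) //= pcoef_pelt eqxx scale1r big1 ?addr0 // => q nq.
by rewrite pcoef_pelt (negPf nq) scale0r.
Qed.

Lemma pcoef_sum (I : finType) (F : I -> KQ) q :
  pcoef (\sum_i F i) q = \sum_i pcoef (F i) q.
Proof. by rewrite /pcoef sum_ffunE. Qed.

Lemma path_expand f : f = path_lin (@pelt K Q) f.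
Proof.
apply: path_algP => q; rewrite pcoef_sum (bigD1 q) //= pcoefZ pcoef_pelt eqxx.
rewrite mulr1 big1 ?addr0 // => p np.
by rewrite pcoefZ pcoef_pelt eq_sym (negPf np) mulr0.
Qed.

Lemma path_linE (V : lmodType K) (g : {linear KQ -> V}) f :
  g f = path_lin (g \o @pelt K Q) f.
Proof.
by rewrite {1}[f]path_expand linear_sum; apply: eq_bigr => p _; rewrite linearZ.
Qed.

Lemma path_lin_mem (V : vectType K) (g : qpath Q -> V) f (W : {vspace V}) :
  (forall p, pcoef f p != 0 -> g p \in W) -> path_lin g f \in W.
Proof.
move=> gW; apply: rpred_sum => p _.
have [->|/gW Wp] := eqVneq (pcoef f p) 0; first by rewrite scale0r mem0v.
exact: rpredZ.
Qed.

Lemma eq_path_lin (V : lmodType K) (g h : qpath Q -> V) f :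
  (forall p, pcoef f p != 0 -> g p = h p) -> path_lin g f = path_lin h f.
Proof.
move=> gh; apply: eq_bigr => p _.
have [->|/gh -> //] := eqVneq (pcoef f p) 0; by rewrite !scale0r.
Qed.

Definition par_space u w : {vspace KQ} := vspan (parallel_comb u w).

Lemma par_spaceP u w f : f \in par_space u w <-> parallel_comb u w f.
Proof.
apply: vspan_id => [p|k g h hg hh p].
  by rewrite /pcoef ffunE eqxx.
rewrite pcoefD pcoefZ; have [g0|/hg//] := eqVneq (pcoef g p) 0.
by rewrite g0 mulr0 add0r => /hh.
Qed.

Lemma pelt_par p : pelt K p \in par_space (pstart p) (pend p).
Proof.
apply/par_spaceP => q; rewrite pcoef_pelt.
by have [->|_] := eqVneq q p; last move=> /eqP[].
Qed.

Lemma ptriv_mull u p : pelt K (ptriv u) ** pelt K p =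
  (u == pstart p)%:R *: pelt K p.
Proof.
have [->|ne] := eqVneq u (pstart p).
  by rewrite scale1r; apply: peltM; rewrite /Defs.pcomp !eqxx.
by rewrite scale0r peltM0.
Qed.

Lemma ptriv_mulr w p : pelt K p ** pelt K (ptriv w) =
  (pend p == w)%:R *: pelt K p.
Proof.
have [<-|ne] := eqVneq (pend p) w.
  by rewrite scale1r; apply: peltM; rewrite /Defs.pcomp cats0 !eqxx.
by rewrite scale0r peltM0.
Qed.

Lemma ptriv_mulm u w f : pelt K (ptriv u) ** f ** pelt K (ptriv w) =
  path_lin (fun p => ((u == pstart p) && (pend p == w))%:R *: pelt K p) f.
Proof.
have lin : linear (fun g : KQ => pelt K (ptriv u) ** g ** pelt K (ptriv w)).
  by move=> k g h; rewrite amulPr amulPl.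
have [F FE] := linear_hom lin.
rewrite -FE path_linE; apply: eq_path_lin => p _ /=.
by rewrite FE ptriv_mull amulZl ptriv_mulr scalerA -natrM mulnb.
Qed.

Lemma ptriv_mul_par u w f :
  pelt K (ptriv u) ** f ** pelt K (ptriv w) \in par_space u w.
Proof.
rewrite ptriv_mulm; apply: path_lin_mem => p _.
have [->|_] := eqVneq u (pstart p); last by rewrite scale0r mem0v.
have [<-|_] := eqVneq (pend p) w; last by rewrite scale0r mem0v.
by rewrite scale1r pelt_par.
Qed.

Lemma ptriv_mul_id u w f : parallel_comb u w f ->
  pelt K (ptriv u) ** f ** pelt K (ptriv w) = f.
Proof.
move=> par; rewrite ptriv_mulm [RHS]path_expand; apply: eq_path_lin => p /par[-> ->].
by rewrite !eqxx scale1r.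
Qed.

(** Multiplying a combination of parallel paths by arbitrary elements only sees
    the paths that end, or start, where the parallel paths start, or end.  So
    membership in a subspace can be tested on paths. *)
Lemma par_mul_mem (W : {vspace KQ}) u w f : parallel_comb u w f ->
  (forall p q, pend p = u -> pstart q = w -> pelt K p ** f ** pelt K q \in W) ->
  forall a b, a ** f ** b \in W.
Proof.
move=> par Wpq a b.
have [F FE] : {g : 'Hom(KQ, KQ) | forall x, g x = x ** f ** b}.
  by apply: linear_hom => k g h; rewrite !amulPl.
rewrite -FE path_linE; apply: path_lin_mem => p _ /=; rewrite FE.
have [G GE] : {g : 'Hom(KQ, KQ) | forall x, g x = pelt K p ** f ** x}.
  by apply: linear_hom => k g h; rewrite !amulPr.
rewrite -GE path_linE; apply: path_lin_mem => q _ /=; rewrite GE.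
rewrite -(ptriv_mul_id par) !amulA ptriv_mulr -[_ ** pelt K q]amulA ptriv_mull.
have [e|_] := eqVneq (pend p) u; last by rewrite scale0r !amul0l mem0v.
have [e'|_] := eqVneq w (pstart q); last by rewrite scale0r amul0r mem0v.
by rewrite !scale1r; apply: Wpq.
Qed.

End ParallelPaths.

(** * Cartan matrices of bound quivers *)

Section BoundQuivers.
Variables (K : fieldType) (L : bquiver K).
Local Notation Q := (bq_quiver L).
Local Notation J := (bq_ideal L).

Definition bq_pi : 'Hom(path_alg K Q, bq_alg L) := linfun (quot_pi J).

Lemma bq_piE f : bq_pi f = quot_pi J f.
Proof. by rewrite lfunE. Qed.

Lemma bq_pi_eq0 f : (bq_pi f == 0) = (f \in (J : {vspace _})).
Proof. by rewrite bq_piE quot_pi_eq0. Qed.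

(** The idempotents cut out, from the image of any element, the image of its part
    supported on paths with the right ends. *)
Lemma cartan_bq (i j : vertex Q) :
  cartan (fun x : vertex Q => bq_idem x : bq_alg L) i j
    = \dim (bq_pi @: par_space K j i).
Proof.
rewrite cartanE ?idem_mul //; congr (\dim _); apply/vspaceP => y.
have piM f : (bq_idem j : bq_alg L) ** quot_pi J f ** (bq_idem i : bq_alg L)
    = quot_pi J (pelt K (ptriv j) ** f ** pelt K (ptriv i)).
  by rewrite !quot_piM.
apply/idP/idP => [/peirceP[x ->]|/memv_imgP[f /par_spaceP fP ->]].
  rewrite -[x]quot_liftK piM -bq_piE; apply: memv_img; exact: ptriv_mul_par.
by apply/peirceP; exists (quot_pi J f); rewrite piM ptriv_mul_id // bq_piE.
Qed.

Lemma cartan_corner (v : vertex Q) (x y : {x : vertex Q | x != v}) :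
  cartan (fun x : {x : vertex Q | x != v} =>
      corner_compress (bq_coidem v) (bq_idem (val x))) x y
    = cartan (fun x : vertex Q => bq_idem x : bq_alg L) (val x) (val y).
Proof.
have ort (i j : vertex Q) : i != j ->
    (bq_idem i : bq_alg L) ** (bq_idem j : bq_alg L) = 0.
  by move=> ne; rewrite /= -[LHS]quot_piM peltM0 // linear0.
have cl (i : {x : vertex Q | x != v}) :
    (bq_coidem v : bq_alg L) ** (bq_idem (val i) : bq_alg L) = bq_idem (val i).
  by rewrite [bq_coidem v : bq_alg L]/= amulBl amul1l ort ?subr0 // eq_sym (valP i).
have cr (i : {x : vertex Q | x != v}) :
    (bq_idem (val i) : bq_alg L) ** (bq_coidem v : bq_alg L) = bq_idem (val i).
  by rewrite [bq_coidem v : bq_alg L]/= amulBr amul1r ort ?subr0 // (valP i).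
have cv (i : {x : vertex Q | x != v}) :
    corner_val (corner_compress (bq_coidem v) (bq_idem (val i)))
    = bq_idem (val i).
  by rewrite -[RHS](cr i) -[X in _ = X ** _](cl i).
have id (i : {x : vertex Q | x != v}) :
    corner_compress (bq_coidem v) (bq_idem (val i))
      ** corner_compress (bq_coidem v) (bq_idem (val i))
    = corner_compress (bq_coidem v) (bq_idem (val i)).
  by apply: corner_val_inj; rewrite corner_valM cv idem_mul.
rewrite [LHS]cartanE // cartanE ?idem_mul //.
by rewrite dim_peirce_corner.
Qed.

Hypothesis triL : is_triangular L.

(** The relations involve paths of length at least 2, and no product of paths
    with such a path is trivial. *)
Lemma triangular_pcoef0 f p :
  f \in (J : {vspace _}) -> parrows p = [::] -> pcoef f p = 0.
Proof.
case: triL => R [Rlong ->] /= Jf p0.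
have [F FE] : {g : 'Hom(path_alg K Q, K^o) | forall x, g x = pcoef x p}.
  by apply: linear_hom => k g h; rewrite pcoefD pcoefZ.
suff : f \in lker F by rewrite memv_ker FE => /eqP.
apply: subvP Jf.
apply: vspan_subvP => _ [a [r [b [/Rlong[_ long] ->]]]].
have mul0 (g h : path_alg K Q) :
    (forall q, parrows q = [::] -> pcoef g q = 0) \/
    (forall q, parrows q = [::] -> pcoef h q = 0) ->
    forall q, parrows q = [::] -> pcoef (g ** h) q = 0.
  move=> gh q q0; rewrite [LHS]pcoefM; apply: big1 => s _; apply: big1 => t _.
  have [/and3P[_ _ /eqP]|_] := boolP (Defs.pcomp s t q); last by rewrite mulr0.
  rewrite q0; case es: (parrows s) => //; case et: (parrows t) => // _.
  case: gh => gh0; first by rewrite (gh0 s) // !mul0r.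
  by rewrite (gh0 t) // mulr0 mul0r.
rewrite memv_ker FE; apply/eqP; apply: (mul0 _ _ _ p p0); left=> q q0.
apply: (mul0 _ _ _ q q0); right=> s s0; apply/eqP/negPn/negP => /long.
by rewrite s0.
Qed.

Lemma cartan_diag (i : vertex Q) :
  cartan (fun x : vertex Q => bq_idem x : bq_alg L) i i = 1%N.
Proof.
rewrite cartan_bq.
have -> : par_space K i i = <[pelt K (ptriv i)]>%VS.
  apply/eqP; rewrite eqEsubv; apply/andP; split; last first.
    by rewrite -memvE; apply: (pelt_par K (ptriv i)).
  apply/subvP => f /par_spaceP fP; rewrite [f]path_expand.
  apply: path_lin_mem => p /fP[si ei].
  have -> : p = ptriv i by apply: qpath_inj; rewrite // loop_trivial // si.
  exact: memv_line.
rewrite limg_line dim_vline bq_pi_eq0.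
case: (boolP (_ \in _)) => // /triangular_pcoef0 - /(_ (ptriv i) erefl) /eqP.
by rewrite pcoef_pelt eqxx oner_eq0.
Qed.

End BoundQuivers.

(** * Paths in Hasse quivers *)

Section HassePaths.
Variables (d : Order.disp_t) (S : finPOrderType d).
Implicit Types (s t : S) (q : qpath (hasse S)).

Lemma hasse_path_le q : (pstart q <= pend q :> S)%O.
Proof.
have := hasse_walk_lt (qpathP q); rewrite -/(parrows q) -/(pend q).
have [q0 _|_ /(_ isT)] := eqVneq (parrows q) [::]; last exact: ltW.
by rewrite /pend q0.
Qed.

Lemma hasse_path_ex s t : (s <= t)%O ->
  exists q, pstart q = s /\ pend q = t.
Proof.
have [n] := ubnP #|[set u : S | (s <= u <= t)%O]|.
elim: n s t => // n IH s t card_st le_st.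
have [->|ne_st] := eqVneq s t; first by exists (@ptriv (hasse S) t).
have lt_st : (s < t)%O by rewrite lt_neqAle ne_st.
have [cov|] := boolP (covered s t).
  have ok : walk (@src (hasse S)) (@tgt (hasse S)) s [:: exist _ (s, t) cov].
    by rewrite /= eqxx.
  by exists (@QPath (hasse S) (s, [:: exist _ (s, t) cov]) ok).
rewrite /covered lt_st /= negb_forall => /existsP[u].
rewrite negbK => /andP[lt_su lt_ut].
have [||q1 [s1 e1]] := IH s u; last 1 first.
- have [||q2 [s2 e2]] := IH u t; last 1 first.
  + have [q q12] := pcomp_ex (etrans s2 (esym e1)); exists q.
    by rewrite (pcomp_end q12); case/and3P: q12 => /eqP ->.
  + apply: leq_trans (proper_card _) card_st; apply/properP.
    split; last by exists s; rewrite inE ?lexx ?le_st // lt_geF.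
    by apply/subsetP => w; rewrite !inE => /andP[/(le_trans (ltW lt_su)) ->].
  + exact: ltW.
- apply: leq_trans (proper_card _) card_st; apply/properP.
  split; last by exists t; rewrite inE ?lexx ?le_st // andbC lt_geF.
  by apply/subsetP => w; rewrite !inE => /andP[-> /le_trans -> //]; apply: ltW.
- exact: ltW.
Qed.

Lemma minimal_below t : exists2 m : S, minimal m & (m <= t)%O.
Proof.
pose rk m := #|[set u : S | (u < m)%O]|.
have [m le_mt min_m] := @arg_minnP _ t (fun m => (m <= t)%O) rk (lexx t).
exists m => //; apply/forallP => u; apply/negP => lt_um.
have := min_m u (le_trans (ltW lt_um) le_mt); rewrite leqNgt => /negP[].
apply: proper_card; apply/properP; split; last by exists u; rewrite inE ?ltxx.
by apply/subsetP => w; rewrite !inE => /lt_trans; apply.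
Qed.

Lemma maximal_above t : exists2 m : S, maximal m & (t <= m)%O.
Proof.
pose rk m := #|[set u : S | (m < u)%O]|.
have [m le_tm min_m] := @arg_minnP _ t (fun m => (t <= m)%O) rk (lexx t).
exists m => //; apply/forallP => u; apply/negP => lt_mu.
have := min_m u (le_trans le_tm (ltW lt_mu)); rewrite leqNgt => /negP[].
apply: proper_card; apply/properP; split; last by exists u; rewrite inE ?ltxx.
by apply/subsetP => w; rewrite !inE; apply: lt_trans.
Qed.

End HassePaths.

(** * Words in the inserted quiver *)

Section Words.
Variables (K : fieldType) (L : bquiver K) (v : vertex (bq_quiver L)).
Variables (d : Order.disp_t) (S : finPOrderType d).
Local Notation Q := (bq_quiver L).
Local Notation QS := (hasse S).
Local Notation Q' := (ins_quiver v S).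
Local Notation rsrc := (@raw_src K L d S).
Local Notation rtgt := (@raw_tgt K L d S).
Implicit Types (x y : raw_vertex L S) (w : seq (raw_arrow L S)).
Implicit Types (p : qpath Q) (q : qpath QS).

Definition raw_ok x w : bool :=
  [&& ins_vertex_pred v x, walk rsrc rtgt x w & all (@ins_arrow_pred K L v d S) w].

Lemma qpath_raw_ok (p : qpath Q') :
  raw_ok (val (pstart p)) (map val (parrows p)) /\
  walk_end rtgt (val (pstart p)) (map val (parrows p)) = val (pend p).
Proof.
have := qpathP p; rewrite /raw_ok (valP (pstart p)) /pend.
rewrite -/(pstart p) -/(parrows p).
elim: (parrows p) (pstart p) => //= r w IH x /andP[/eqP <- /IH[/andP[ww aw] we]].
by rewrite /= eqxx ww aw (valP r).
Qed.

Lemma raw_ok_path x w : raw_ok x w ->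
  exists p : qpath Q', val (pstart p) = x /\ map val (parrows p) = w.
Proof.
elim: w x => [|r w IH] x.
  by case/and3P=> vx _ _; exists (@ptriv Q' (Sub x vx)).
case/and3P=> vx /= /andP[/eqP sr ww] /andP[ar aw].
pose r' : ins_arrow v S := Sub r ar.
have [p [sp ap]] : exists p : qpath Q',
    val (pstart p) = rtgt r /\ map val (parrows p) = w.
  apply: IH; rewrite /raw_ok ww aw !andbT; exact: ins_tgtP r'.
have ok : walk (@src Q') (@tgt Q') (Sub x vx : ins_vertex v S) (r' :: parrows p).
  apply/andP; split; first by apply/eqP/val_inj.
  have -> : tgt (r' : arrow Q') = pstart p by apply: val_inj; rewrite sp.
  exact: qpathP.
exists (@QPath Q' ((Sub x vx : ins_vertex v S), r' :: parrows p) ok).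
by rewrite /parrows /= -/(parrows p) ap.
Qed.

Lemma word_pelt (p : qpath Q') :
  word v (val (pstart p)) (map val (parrows p)) = pelt K p.
Proof.
apply/ffunP => r; rewrite !ffunE; congr (nat_of_bool _)%:R.
apply/andP/eqP => [[/eqP e1 /eqP e2]|->]; last by rewrite !eqxx.
by apply: qpath_inj; [apply: val_inj | apply: (inj_map val_inj)].
Qed.

Lemma wordP x w : raw_ok x w -> exists p : qpath Q',
  [/\ word v x w = pelt K p, val (pstart p) = x,
      val (pend p) = walk_end rtgt x w & map val (parrows p) = w].
Proof.
move=> /raw_ok_path[p [<- <-]]; exists p; split=> //; first exact: word_pelt.
by case: (qpath_raw_ok p).
Qed.

Lemma word_eq0 x w : ~~ raw_ok x w -> word v x w = 0.
Proof.
move=> bad; apply/ffunP => p; rewrite !ffunE.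
case: eqP => //= ex; case: eqP => //= ew; case/negP: bad.
by rewrite -ex -ew; case: (qpath_raw_ok p).
Qed.

Lemma raw_ok_cat x w1 w2 :
  raw_ok x (w1 ++ w2) = raw_ok x w1 && raw_ok (walk_end rtgt x w1) w2.
Proof.
rewrite /raw_ok walk_cat all_cat.
have [[p [<- <-]]|bad] : (exists p : qpath Q',
    val (pstart p) = x /\ map val (parrows p) = w1) \/ ~~ raw_ok x w1.
  by case: (boolP (raw_ok x w1)) => [/raw_ok_path|]; [left | right].
  have [/and3P[-> -> ->] ->] := qpath_raw_ok p.
  by rewrite (valP (pend p)).
move: bad; rewrite /raw_ok.
case: (ins_vertex_pred v x) => //=; case: (walk _ _ _ _) => //= /negPf ->.
by rewrite /= andbF.
Qed.

(** If the concatenation is not a path then one of the factors is not one either,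
    and both sides vanish.  So the words in the relations can be cut and pasted
    freely. *)
Lemma word_cat x w1 w2 :
  word v x (w1 ++ w2) = word v x w1 ** word v (walk_end rtgt x w1) w2.
Proof.
have ok := raw_ok_cat x w1 w2.
case ok1: (raw_ok x w1) ok => ok; last first.
  by rewrite word_eq0 ?ok // (word_eq0 (negbT ok1)) amul0l.
case ok2: (raw_ok (walk_end rtgt x w1) w2) ok => ok; last first.
  by rewrite word_eq0 ?ok // (word_eq0 (negbT ok2)) amul0r.
have [p1 [-> s1 e1 a1]] := wordP ok1.
have [p2 [-> s2 _ a2]] := wordP ok2.
have [p [-> s _ a]] := wordP ok.
symmetry; apply: peltM; apply/and3P; split; apply/eqP.
- by apply: val_inj; rewrite s s1.
- by apply: val_inj; rewrite s2 e1.
- by apply: (inj_map val_inj); rewrite map_cat a a1 a2.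
Qed.

Lemma word_par x y w : walk_end rtgt x w = y ->
  forall (x' y' : ins_vertex v S), val x' = x -> val y' = y ->
  word v x w \in par_space K (x' : vertex Q') (y' : vertex Q').
Proof.
move=> we x' y' ex ey.
case ok: (raw_ok x w); last by rewrite word_eq0 ?ok ?mem0v.
have [p [-> sp ep _]] := wordP ok.
have -> : x' = pstart p by apply: val_inj; rewrite sp.
have -> : y' = pend p by apply: val_inj; rewrite ep we.
exact: pelt_par.
Qed.

(** ** Contracting the inserted poset to a point *)

Definition raw_collapse x : vertex Q := if x is inl y then y else v.
Definition raw_collapse_arrow (r : raw_arrow L S) : seq (arrow Q) :=
  match r with
  | inl (inl g) => [:: g]
  | inl (inr _) => [::]
  | inr (inl (a, _)) => [:: a]
  | inr (inr (_, b)) => [:: b]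
  end.
Definition raw_collapse_word w := flatten (map raw_collapse_arrow w).

Lemma raw_collapse_cons r w :
  raw_collapse_word (r :: w) = raw_collapse_arrow r ++ raw_collapse_word w.
Proof. by []. Qed.

Lemma raw_collapse_cat w1 w2 :
  raw_collapse_word (w1 ++ w2) = raw_collapse_word w1 ++ raw_collapse_word w2.
Proof. by rewrite /raw_collapse_word map_cat flatten_cat. Qed.

Definition collapse_path (p : qpath Q') : qpath Q :=
  @QPath Q (collapse (pstart p), flatten (map (@collapse_arrow K L v d S) (parrows p)))
    (proj1 (collapse_walk (qpathP p))).

Lemma collapse_path_start (p : qpath Q') :
  pstart (collapse_path p) = raw_collapse (val (pstart p)).
Proof. by []. Qed.

Lemma collapse_path_end (p : qpath Q') :
  pend (collapse_path p) = raw_collapse (val (pend p)).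
Proof. exact: (proj2 (collapse_walk (qpathP p))). Qed.

Lemma collapse_path_arrows (p : qpath Q') :
  parrows (collapse_path p) = raw_collapse_word (map val (parrows p)).
Proof. by rewrite /raw_collapse_word -map_comp. Qed.

Definition contraction : path_alg K Q' -> path_alg K Q :=
  path_lin (fun p : qpath Q' => pelt K (collapse_path p)).
HB.instance Definition _ := GRing.Linear.copy contraction
  (path_lin (fun p : qpath Q' => pelt K (collapse_path p))).

Lemma contraction_pelt (p : qpath Q') :
  contraction (pelt K p) = pelt K (collapse_path p).
Proof. exact: path_lin_pelt. Qed.

Lemma contraction_word x w p : raw_ok x w ->
  pstart p = raw_collapse x -> parrows p = raw_collapse_word w ->
  contraction (word v x w) = pelt K p.
Proof.
move=> /wordP[p' [-> sp _ ap]] sx aw; rewrite contraction_pelt; congr pelt.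
apply: qpath_inj; first by rewrite collapse_path_start sp sx.
by rewrite collapse_path_arrows ap aw.
Qed.

(** Collapsing is multiplicative on paths that compose, but not in general: two
    paths meeting at different elements of the poset multiply to zero before
    collapsing only. *)
Lemma contraction_mul (p q : qpath Q') f :
  parallel_comb (pend p) (pstart q) f ->
  contraction (pelt K p ** f ** pelt K q) =
    pelt K (collapse_path p) ** contraction f ** pelt K (collapse_path q).
Proof.
move=> par.
have compM (s t : qpath Q') : pend s = pstart t ->
    exists2 r, Defs.pcomp s t r & contraction (pelt K s ** pelt K t)
      = pelt K (collapse_path s) ** pelt K (collapse_path t).
  move=> st; have [r srt] := pcomp_ex (esym st); exists r => //.
  rewrite (peltM K srt) contraction_pelt; symmetry; apply: peltM.
  case/and3P: srt => /eqP sr /eqP et /eqP ar.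
  rewrite /Defs.pcomp collapse_path_end !collapse_path_start sr et !eqxx.
  by rewrite !collapse_path_arrows ar map_cat raw_collapse_cat eqxx.
have [F FE] : {g : 'Hom(path_alg K Q', path_alg K Q) |
    forall h, g h = contraction (pelt K p ** h ** pelt K q)}.
  by apply: linear_hom => k g h; rewrite amulPr amulPl linearP.
have [G GE] : {g : 'Hom(path_alg K Q', path_alg K Q) | forall h, g h =
    pelt K (collapse_path p) ** contraction h ** pelt K (collapse_path q)}.
  by apply: linear_hom => k g h; rewrite linearP amulPr amulPl.
rewrite -FE -GE (path_linE F) (path_linE G); apply: eq_path_lin => s /par[ps sq] /=.
rewrite FE GE contraction_pelt.
have [r psr <-] := compM p s (esym ps).
rewrite (peltM K psr) contraction_pelt -contraction_pelt.
have [|t _ ->] := compM r q; first by rewrite (pcomp_end psr).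
by rewrite contraction_pelt.
Qed.

End Words.

(** * Lifting paths to the inserted quiver *)

Section WalksThroughVertex.
Variables (Q : quiver) (v : vertex Q).
Implicit Types (u : vertex Q) (w : seq (arrow Q)) (a b : arrow Q).
Local Notation wk := (walk (@src Q) (@tgt Q)).

Definition avoids w : bool := all (fun a => (src a != v) && (tgt a != v)) w.

Lemma walk_avoids u w :
  u != v -> wk u w -> all (fun a => tgt a != v) w -> avoids w.
Proof.
elim: w u => //= a w IH u nu /andP[/eqP -> ww] /andP[na /(IH _ na ww) ->].
by rewrite nu na.
Qed.

Lemma avoids_end u w : u != v -> avoids w -> walk_end (@tgt Q) u w != v.
Proof.
by elim: w u => //= a w IH u _ /andP[/andP[_ na] aw]; apply: IH na aw.
Qed.

Lemma walk_from_avoids w : wk v w -> all (fun a => tgt a != v) w.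
Proof.
move=> /(walk_uniq (quiver_acyclic (q := Q)))/andP[nv _].
by apply/allP => a aw; apply: contra nv => /eqP <-; apply: map_f.
Qed.

Lemma walk_fromP w : wk v w -> w = [::] \/
  exists b w', [/\ w = b :: w', src b = v, tgt b != v & avoids w'].
Proof.
case: w => [|b w] ww; [by left | right; exists b, w].
have /= /andP[tb tw] := walk_from_avoids ww.
case/andP: ww => /eqP sb ww.
by split=> //; apply: walk_avoids ww tw.
Qed.

(** A walk that starts away from [v] meets [v] at most once, because there are
    no oriented cycles. *)
Lemma walk_throughP u w : u != v -> wk u w -> avoids w \/
  exists w1 a w2, [/\ w = w1 ++ a :: w2, avoids w1, src a != v, tgt a = v
    & wk v w2].
Proof.
elim: w u => [|a w IH] u nu /=; first by left.
case/andP=> /eqP sa ww; have [ta|na] := eqVneq (tgt a) v.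
  by right; exists [::], a, w; rewrite -ta sa; split; rewrite // ta.
have [aw|[w1 [b [w2 [-> aw1 sb tb ww2]]]]] := IH _ na ww.
  by left; rewrite sa nu.
by right; exists (a :: w1), b, w2; split; rewrite //= sa nu na.
Qed.

End WalksThroughVertex.

Section Lifts.
Variables (K : fieldType) (L : bquiver K) (v : vertex (bq_quiver L)).
Variables (d : Order.disp_t) (S : finPOrderType d).
Local Notation Q := (bq_quiver L).
Local Notation QS := (hasse S).
Local Notation Q' := (ins_quiver v S).
Local Notation rsrc := (@raw_src K L d S).
Local Notation rtgt := (@raw_tgt K L d S).
Local Notation rpred := (@ins_arrow_pred K L v d S).
Local Notation rcoll := (@raw_collapse K L v d S).
Implicit Types (x y : raw_vertex L S) (q : qpath QS) (w : seq (arrow Q)).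
Implicit Types (p : qpath Q).

(** The passage of [w] through [v] is replaced by [q]. *)
Definition thread q w : seq (raw_arrow L S) := flatten [seq
  (if tgt a == v then into a (pstart q) :: inner_word L q
   else if src a == v then [:: outof (pend q) a]
   else [:: old S a]) | a <- w].

(** A path starting in the poset has no arrow into [v] to trigger the insertion
    of [q], so that [q] has to come first. *)
Definition lift_word x q w : seq (raw_arrow L S) :=
  (if x is inr _ then inner_word L q else [::]) ++ thread q w.

(** The segments that can be inserted in a path from [x] to [y]: an end in the
    poset prescribes the corresponding end of [q], while arrows of the old quiver
    reach the poset at minimal elements and leave it at maximal ones. *)
Definition fits x y q : Prop :=
  (if x is inr s then pstart q = s else minimal (pstart q : S)) /\
  (if y is inr t then pend q = t else maximal (pend q : S)).

Lemma thread_cat q w1 w2 : thread q (w1 ++ w2) = thread q w1 ++ thread q w2.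
Proof. by rewrite /thread map_cat flatten_cat. Qed.

Lemma thread_avoids q w : avoids v w -> thread q w = map (old S) w.
Proof.
elim: w => //= a w IH /andP[/andP[/negPf sa /negPf ta] /IH <-].
by rewrite /thread /= ta sa.
Qed.

Lemma thread_into q a w : tgt a = v ->
  thread q (a :: w) = into a (pstart q) :: inner_word L q ++ thread q w.
Proof. by move=> ta; rewrite /thread /= ta eqxx. Qed.

Lemma thread_outof q b w : src b = v -> tgt b != v ->
  thread q (b :: w) = outof (pend q) b :: thread q w.
Proof. by move=> sb /negPf tb; rewrite /thread /= tb sb eqxx. Qed.

Lemma thread_old q a w : src a != v -> tgt a != v ->
  thread q (a :: w) = old S a :: thread q w.
Proof. by move=> /negPf sa /negPf ta; rewrite /thread /= ta sa. Qed.

Lemma inner_walk q :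
  walk rsrc rtgt (inr (pstart q)) (inner_word L q) /\
  walk_end rtgt (inr (pstart q)) (inner_word L q) = inr (pend q).
Proof.
have := qpathP q; rewrite /pend /inner_word -/(parrows q) -/(pstart q).
elim: (parrows q) (pstart q) => //= a w IH s /andP[/eqP <- /IH[ww we]].
by split; [rewrite eqxx | ].
Qed.

Lemma inner_pred q : all rpred (inner_word L q).
Proof. by apply/allP => _ /mapP[a _ ->]. Qed.

Lemma inner_raw_ok q : raw_ok v (inr (pstart q)) (inner_word L q).
Proof. by rewrite /raw_ok inner_pred (proj1 (inner_walk q)). Qed.

Lemma inner_collapse q : raw_collapse_word (inner_word L q) = [::].
Proof. by rewrite /inner_word /raw_collapse_word; elim: (parrows q). Qed.

Lemma thread_collapse q w : raw_collapse_word (thread q w) = w.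
Proof.
elim: w => //= a w IH.
rewrite -cat1s thread_cat raw_collapse_cat IH /thread /= cats0.
case: ifP => _; last by case: ifP.
by rewrite -cat1s raw_collapse_cat inner_collapse.
Qed.

Lemma lift_collapse x q w : raw_collapse_word (lift_word x q w) = w.
Proof.
by case: x => x; rewrite /lift_word raw_collapse_cat ?inner_collapse thread_collapse.
Qed.

(** Where the threaded walk stands when the original walk stands at [u]. *)
Definition after q u : raw_vertex L S := if u == v then inr (pend q) else inl u.

Lemma walk_end_inner q r : walk_end rtgt (inr (pstart q)) (inner_word L q ++ r)
  = walk_end rtgt (inr (pend q)) r.
Proof. by rewrite -(proj2 (inner_walk q)) /walk_end map_cat last_cat. Qed.

Lemma thread_walk q u w : walk (@src Q) (@tgt Q) u w ->
  walk rsrc rtgt (after q u) (thread q w) /\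
  walk_end rtgt (after q u) (thread q w) = after q (walk_end (@tgt Q) u w).
Proof.
elim: w u => //= a w IH u /andP[/eqP <- /IH[ww we]].
have [ta|na] := eqVneq (tgt a) v.
  have sa : after q (src a) = inl (src a).
    by rewrite /after -ta (negPf (no_loop a)).
  have [iw ie] := inner_walk q.
  have aq : after q (tgt a) = inr (pend q) by rewrite /after ta eqxx.
  rewrite thread_into // sa /= eqxx walk_cat iw ie /=.
  split; first by rewrite -aq.
  by rewrite [LHS]walk_end_inner -aq.
have aq : after q (tgt a) = inl (tgt a) by rewrite /after (negPf na).
rewrite aq in ww we.
have [sa|ns] := eqVneq (src a) v.
  by rewrite thread_outof // /after sa eqxx /= eqxx; split.
rewrite thread_old //.
by rewrite {1 2}/after (negPf ns) /= eqxx; split.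
Qed.

(** Minimality of the start of [q] is required only if some arrow enters [v], which
    cannot happen when the path starts at [v], and dually for its end. *)
Lemma lift_raw_ok x y q p :
  ins_vertex_pred v x -> ins_vertex_pred v y ->
  pstart p = rcoll x -> pend p = rcoll y -> fits x y q ->
  raw_ok v x (lift_word x q (parrows p)) /\
  walk_end rtgt x (lift_word x q (parrows p)) = y.
Proof.
move=> vx vy sp ep [fx fy].
have pw : walk (@src Q) (@tgt Q) (rcoll x) (parrows p).
  by rewrite -sp; apply: qpathP.
have pe : walk_end (@tgt Q) (rcoll x) (parrows p) = rcoll y by rewrite -ep -sp.
have [tw te] := thread_walk q pw.
have afty : after q (rcoll y) = y.
  case: (y) vy fy => [u|t]; rewrite /after /ins_vertex_pred /=.
    by move=> nu _; case: (u =P v) nu => // ->; rewrite eqxx.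
  by rewrite eqxx => _ ->.
rewrite pe afty in te.
have min_into a : a \in parrows p -> tgt a = v -> minimal (pstart q : S).
  case: (x) fx pw => //= s _ /walk_from_avoids/allP nv ain ta.
  by have := nv a ain; rewrite ta eqxx.
have max_outof a : a \in parrows p -> src a = v -> maximal (pend q : S).
  case: (y) fy pe => //= t _ pe ain sa.
  case/splitPr: ain pw pe => w1 w2; rewrite walk_cat /= => /and3P[_ _ ww].
  rewrite /walk_end map_cat last_cat /= => pe.
  have := quiver_acyclic (q := Q) (x := v) (w := a :: w2).
  by rewrite /= sa eqxx ww => /(_ isT pe).
have tp : all rpred (thread q (parrows p)).
  apply/allP => r /flattenP[_ /mapP[a ain ->]].
  have [ta|na] := eqVneq (tgt a) v.
    rewrite inE => /orP[/eqP -> /=|]; last exact: (allP (inner_pred q)).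
    by rewrite ta eqxx; apply: min_into ta.
  have [sa|ns] := eqVneq (src a) v; rewrite inE => /eqP -> /=.
    by rewrite sa eqxx; apply: max_outof sa.
  by rewrite ns na.
rewrite /raw_ok vx /lift_word all_cat tp andbT.
case: (x) vx fx tw te => [u|s] /=.
  move=> nu _; rewrite /after; case: (u =P v) nu => [->|_ _ -> ->]; last by [].
  by rewrite /ins_vertex_pred eqxx.
rewrite /after eqxx => _ <- tw te; rewrite inner_pred andbT walk_cat.
have [iw ie] := inner_walk q; rewrite iw ie tw; split=> //.
by rewrite walk_end_inner.
Qed.

Definition lifted x q p : path_alg K Q' := word v x (lift_word x q (parrows p)).

Lemma contraction_lifted x y q p :
  ins_vertex_pred v x -> ins_vertex_pred v y ->
  pstart p = rcoll x -> pend p = rcoll y -> fits x y q ->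
  contraction (lifted x q p) = pelt K p.
Proof.
move=> vx vy sp ep fq; apply: contraction_word => //; last by rewrite lift_collapse.
by case: (lift_raw_ok vx vy sp ep fq).
Qed.

(** When an end is outside the poset, the corresponding end of [q] can be chosen
    freely among the minimal, or maximal, elements. *)
Lemma fits_ex x y (t0 : S) :
  (if x is inr s then if y is inr t then (s <= t)%O else true else true) ->
  exists q, fits x y q.
Proof.
have path s t : (s <= t)%O -> exists q : qpath QS, pstart q = s /\ pend q = t.
  exact: hasse_path_ex.
case: x y => [u|s] [u'|t] le_xy.
- have [m mm le_m] := minimal_below t0; have [m' mm' le_m'] := maximal_above t0.
  have [q [sq eq]] := path _ _ (le_trans le_m le_m').
  by exists q; rewrite /fits sq eq.
- have [m mm le_m] := minimal_below t.
  by have [q [sq eq]] := path _ _ le_m; exists q; rewrite /fits sq eq.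
- have [m mm le_m] := maximal_above s.
  by have [q [sq eq]] := path _ _ le_m; exists q; rewrite /fits sq eq.
- by have [q [sq eq]] := path _ _ le_xy; exists q; rewrite /fits sq eq.
Qed.

(** A path that leaves the poset cannot come back, as its collapse would return to
    [v]; so its only segment in the poset serves as [q].  The element [t0] supplies
    an arbitrary segment for paths that do not visit the poset. *)
Lemma raw_ok_lift x (w : seq (raw_arrow L S)) (t0 : S) : raw_ok v x w ->
  exists2 q, fits x (walk_end rtgt x w) q &
    w = lift_word x q (raw_collapse_word w).
Proof.
elim: w x => [|r w IH] x.
  case: x => [u|s] _ /=; last by exists (@ptriv QS s).
  by have [q fq] := @fits_ex (inl u) (inl u) t0 isT; exists q.
move=> ok; have := ok; rewrite -cat1s raw_ok_cat => /andP[_].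
rewrite {1}/walk_end /= => okw; have [q [fx fy] ew] := IH _ okw.
have [p [sp ap ep]] : exists p : qpath Q, [/\ pstart p = rcoll (rtgt r),
    parrows p = raw_collapse_word w & pend p = rcoll (walk_end rtgt (rtgt r) w)].
  have [p' [_ sp ep ap]] := wordP okw; exists (collapse_path p').
  by rewrite collapse_path_start sp collapse_path_arrows ap collapse_path_end ep.
have pw : walk (@src Q) (@tgt Q) (rcoll (rtgt r)) (raw_collapse_word w).
  by rewrite -sp -ap; apply: qpathP.
rewrite raw_collapse_cons.
rewrite -[walk_end rtgt x (r :: w)]/(walk_end rtgt (rtgt r) w).
case/and3P: ok => _ /= /andP[/eqP <- _] /andP[ar _].
case: r ar okw fx fy sp ep pw ew => [[g|a]|[[a s]|[s b]]] /= ar okw fx fy sp ep pw ew.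
- exists q; first by [].
  by case/andP: ar => ns nt; rewrite /lift_word /= thread_old // {1}ew.
- have ok : walk (@src QS) (@tgt QS) (src (a : arrow QS)) (a :: parrows q).
    by rewrite /= eqxx -fx; apply: qpathP.
  pose q' : qpath QS := @QPath QS (src (a : arrow QS), a :: parrows q) ok.
  have eq' : pend q' = pend q.
    by rewrite /pend /q' /walk_end /parrows /pstart /= -fx.
  exists q'; first by split=> //; rewrite eq'.
  rewrite {1}ew /lift_word /= /inner_word /=; congr (_ :: _ ++ _).
  have [->//|[b [w' [-> sb nb aw']]]] := walk_fromP pw.
  by rewrite !thread_outof // !thread_avoids // eq'.
- case/andP: ar => /eqP ta ms; exists q; first by split=> //=; rewrite fx.
  by rewrite /lift_word /= thread_into // fx {1}ew /lift_word.
- case/andP: ar => /eqP sb ms.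
  have bw : walk (@src Q) (@tgt Q) v (b :: raw_collapse_word w).
    by rewrite /= sb eqxx.
  exists (@ptriv QS s).
    split=> //=; case ey: (walk_end _ _ _) ep => [u|t] ep.
      exact: ms.
    have be : walk_end (@tgt Q) v (b :: raw_collapse_word w) = v.
      by apply: etrans ep; rewrite /pend sp ap.
    by have := quiver_acyclic bw be.
  have [//|[b' [w' [[<- <-] _ nb aw']]]] := walk_fromP bw.
  rewrite /lift_word /= thread_outof // {1}ew /lift_word /=.
  by rewrite !thread_avoids.
Qed.

End Lifts.

(** * The ideal of the insertion *)

Section InsertionIdeal.
Variables (K : fieldType) (L : bquiver K) (v : vertex (bq_quiver L)).
Variables (d : Order.disp_t) (S : finPOrderType d).
Hypothesis triL : is_triangular L.
Local Notation Q := (bq_quiver L).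
Local Notation QS := (hasse S).
Local Notation Q' := (ins_quiver v S).
Local Notation J := (bq_ideal L).
Local Notation J' := (bq_ideal (insertion v S)).
Local Notation rtgt := (@raw_tgt K L d S).
Local Notation rcoll := (@raw_collapse K L v d S).
Implicit Types (x y : raw_vertex L S) (q : qpath QS) (p : qpath Q).

Lemma thread_pend p q : pstart p != v -> pend p = v ->
  thread v q (parrows p) =
    (if parrows p is a :: w
     then rcons (map (old S) (belast a w)) (into (last a w) (pstart q))
     else [::]) ++ inner_word L q.
Proof.
move=> ns ev.
have pw : walk (@src Q) (@tgt Q) (pstart p) (parrows p) := qpathP p.
have [av|[w1 [a [w2 [ep av1 sa ta ww2]]]]] := walk_throughP ns pw.
  by have := avoids_end ns av; rewrite -/(pend p) ev eqxx.
have w20 : w2 = [::].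
  apply: (quiver_acyclic ww2); apply: etrans ev.
  by rewrite /pend ep /walk_end map_cat last_cat /= ta.
rewrite ep w20 thread_cat thread_avoids // thread_into //.
rewrite cats1 cats0.
case: (w1) => [//|b w] /=.
by rewrite belast_rcons last_rcons /= cat_rcons.
Qed.

Lemma thread_pstart p q : pstart p = v -> pend p != v ->
  thread v q (parrows p) =
    (if parrows p is b :: w then outof (pend q) b :: map (old S) w else [::]).
Proof.
move=> sv ne; have pw : walk (@src Q) (@tgt Q) v (parrows p).
  by rewrite -sv; apply: qpathP.
have [p0|[b [w [-> sb nb aw]]]] := walk_fromP pw.
  by case/eqP: ne; rewrite /pend p0.
by rewrite thread_outof // thread_avoids.
Qed.

Lemma path_into_lifted s p : pstart p != v -> pend p = v ->
  path_into v s p = lifted v (inl (pstart p)) (@ptriv QS s) p.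
Proof. by move=> ns ev; rewrite /lifted /lift_word thread_pend //= cats0. Qed.

Lemma path_outof_lifted s p : pstart p = v -> pend p != v ->
  path_outof v s p = lifted v (inr s) (@ptriv QS s) p.
Proof. by move=> sv ne; rewrite /lifted /lift_word thread_pstart. Qed.

(** A combination of loops in the ideal vanishes, as loops are trivial. *)
Lemma loop_ideal0 u (f : path_alg K Q) (V : lmodType K) (g : qpath Q -> V) :
  f \in (J : {vspace _}) -> parallel_comb u u f -> path_lin g f = 0.
Proof.
move=> Jf par; rewrite /path_lin big1 // => p _.
have [->|/par[sp ep]] := eqVneq (pcoef f p) 0; first by rewrite scale0r.
by rewrite (triangular_pcoef0 triL Jf) ?scale0r ?loop_trivial ?sp.
Qed.

(** ** Contraction maps the new ideal into the old one *)

(** What is needed of a relation.  Parallelism makes contraction multiplicative on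
    the products of the relation with paths. *)
Definition contracts (f : path_alg K Q') : Prop :=
  contraction f \in (J : {vspace _}) /\
  exists x y : vertex Q', parallel_comb x y f.

Lemma contracts_sub x y w w' : raw_ok v x w -> raw_ok v x w' ->
  walk_end rtgt x w = y -> walk_end rtgt x w' = y ->
  raw_collapse_word w = raw_collapse_word w' ->
  contracts (word v x w - word v x w').
Proof.
move=> ok ok' e e' col.
have [p [ep sp tp ap]] := wordP ok; have [p' [ep' sp' tp' ap']] := wordP ok'.
split; last first.
  exists (pstart p), (pend p); apply/par_spaceP.
  by apply: rpredB; apply: (@word_par _ _ _ _ _ x y); rewrite ?sp ?tp.
rewrite linearB /= ep ep' !contraction_pelt.
suff -> : collapse_path p = collapse_path p' by rewrite subrr mem0v.
apply: qpath_inj; first by rewrite !collapse_path_start sp sp'.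
by rewrite !collapse_path_arrows ap ap' col.
Qed.

Lemma contracts_lifted x y g (phi : qpath Q -> path_alg K Q') :
  ins_vertex_pred v x -> ins_vertex_pred v y ->
  g \in (J : {vspace _}) -> parallel_comb (rcoll x) (rcoll y) g ->
  (forall p, pstart p = rcoll x -> pend p = rcoll y ->
     exists2 q, fits x y q & phi p = lifted v x q p) ->
  contracts (path_lin phi g).
Proof.
move=> vx vy Jg par lift_phi; split.
  suff -> : contraction (path_lin phi g) = g by [].
  rewrite [in RHS](path_expand g) linear_sum.
  under eq_bigr do rewrite linearZ.
  apply: (@eq_path_lin _ _ _ (fun p => contraction (phi p))) => p /par[sp ep].
  by have [q fq ->] := lift_phi p sp ep; apply: contraction_lifted fq.
exists (Sub x vx), (Sub y vy); apply/par_spaceP; apply: path_lin_mem.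
move=> p /par[sp ep]; have [q fq ->] := lift_phi p sp ep.
by apply: word_par; case: (lift_raw_ok vx vy sp ep fq).
Qed.

(** The commutativity relations are differences of parallel paths with the same
    collapse, and the others are lifts of elements of the old ideal. *)
Lemma ins_rel_contracts f : ins_rel f -> contracts f.
Proof.
case=> {f}.
- move=> s u g ms Jg par; have [uv|nuv] := eqVneq u v.
    (* the relation may come from a combination of loops at [v] *)
    rewrite uv in par; rewrite [extend _ _](loop_ideal0 _ Jg par).
    split; first by rewrite linear0 mem0v.
    by exists (Sub (inr s) isT), (Sub (inr s) isT); apply/par_spaceP/mem0v.
  apply: (@contracts_lifted (inl u) (inr s)) => // p sp ep.
  exists (@ptriv QS s); first by split.
  by rewrite path_into_lifted ?sp.
- move=> s u g ms Jg par; have [uv|nuv] := eqVneq u v.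
    rewrite uv in par; rewrite [extend _ _](loop_ideal0 _ Jg par).
    split; first by rewrite linear0 mem0v.
    by exists (Sub (inr s) isT), (Sub (inr s) isT); apply/par_spaceP/mem0v.
  apply: (@contracts_lifted (inr s) (inl u)) => // p sp ep.
  exists (@ptriv QS s); first by split.
  by rewrite path_outof_lifted ?ep.
- move=> q q' ss ee; rewrite -ss.
  apply: (@contracts_sub _ (inr (pend q))); rewrite ?inner_collapse //.
  + exact: inner_raw_ok.
  + by rewrite ss; apply: inner_raw_ok.
  + by case: (inner_walk L q).
  + by rewrite ss ee; case: (inner_walk L q').
- move=> a q q' ta mq mq' ee.
  have sa : src a != v by rewrite -ta no_loop.
  have ok (r : qpath QS) : minimal (pstart r : S) ->
      raw_ok v (inl (src a)) (into a (pstart r) :: inner_word L r).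
    move=> mr; rewrite -cat1s raw_ok_cat [X in _ && X]inner_raw_ok.
    by rewrite /raw_ok /= eqxx ta eqxx mr !andbT.
  have we (r : qpath QS) : walk_end rtgt (inl (src a)) (into a (pstart r) :: inner_word L r)
      = inr (pend r) by case: (inner_walk L r).
  apply: (@contracts_sub _ (inr (pend q))); rewrite ?we ?ee ?ok //.
  by rewrite !raw_collapse_cons !inner_collapse.
- move=> b q q' sb mq mq' ss; rewrite -ss.
  have nb : tgt b != v by rewrite -sb eq_sym no_loop.
  have ok (r : qpath QS) : maximal (pend r : S) ->
      raw_ok v (inr (pstart r)) (rcons (inner_word L r) (outof (pend r) b)).
    move=> mr; rewrite -cats1 raw_ok_cat inner_raw_ok (proj2 (inner_walk L r)).
    by rewrite /raw_ok /= eqxx sb eqxx mr.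
  have we (r : qpath QS) : walk_end rtgt (inr (pstart r))
      (rcons (inner_word L r) (outof (pend r) b)) = inl (tgt b).
    by rewrite /walk_end map_rcons last_rcons.
  apply: (@contracts_sub _ (inl (tgt b))); rewrite ?ok ?we //.
  + by rewrite ss ok.
  + by rewrite ss we.
  + by rewrite -!cats1 !raw_collapse_cat !inner_collapse.
- move=> a b q q' ta sb mq mq' nq nq'.
  have sa : src a != v by rewrite -ta no_loop.
  have ok (r : qpath QS) : minimal (pstart r : S) -> maximal (pend r : S) ->
      raw_ok v (inl (src a))
        (into a (pstart r) :: rcons (inner_word L r) (outof (pend r) b)).
    move=> mr nr; rewrite -cat1s raw_ok_cat -cats1 raw_ok_cat.
    rewrite [X in _ && (X && _)]inner_raw_ok.
    rewrite [walk_end _ _ (inner_word _ _)](proj2 (inner_walk L r)).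
    by rewrite /raw_ok /= eqxx ta eqxx mr sb !eqxx nr !andbT.
  have we (r : qpath QS) : walk_end rtgt (inl (src a))
      (into a (pstart r) :: rcons (inner_word L r) (outof (pend r) b))
      = inl (tgt b).
    by rewrite /walk_end /= map_rcons last_rcons.
  apply: (@contracts_sub _ (inl (tgt b))); rewrite ?ok ?we //.
  by rewrite !raw_collapse_cons -!cats1 !raw_collapse_cat !inner_collapse.
- move=> u w g c nu nw Jg par mc.
  apply: (@contracts_lifted (inl u) (inl w)) => // p sp ep.
  by exists (c p); [case: (mc p) | rewrite -[X in inl X]sp].
Qed.

Lemma contraction_ideal f :
  f \in (J' : {vspace _}) -> contraction f \in (J : {vspace _}).
Proof.
have [F FE] : {g : 'Hom(path_alg K Q', path_alg K Q) |
    forall h, g h = contraction h} by apply: linear_hom => k g h; rewrite linearP.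
rewrite -FE memv_preim; apply/subvP: f.
apply: vspan_subvP => _ [a [r [b [/ins_rel_contracts[Jr [x [y par]]] ->]]]].
apply: (par_mul_mem par) => p q ep sq; rewrite -memv_preim FE contraction_mul.
  exact: idealP.
by rewrite ep sq.
Qed.

(** ** Lifting maps the old ideal into the new one *)

Lemma ins_rel_mem f : ins_rel f -> f \in (J' : {vspace _}).
Proof.
by move=> rf; apply: mem_vspan; exists aone, f, aone; rewrite amul1l amul1r.
Qed.

(** Relations may be applied inside a longer path. *)
Lemma word_ctx_mem x w1 w w' w2 :
  let y := walk_end rtgt x w1 in walk_end rtgt y w = walk_end rtgt y w' ->
  word v y w - word v y w' \in (J' : {vspace _}) ->
  word v x (w1 ++ w ++ w2) - word v x (w1 ++ w' ++ w2) \in (J' : {vspace _}).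
Proof.
move=> y e mem; rewrite !word_cat -/y e -amulBr -amulBl amulA.
exact: (idealP (word v x w1)).
Qed.

(** A path that avoids [v] has only one lift.  Otherwise the two lifts differ in a
    single segment, possibly with the adjacent arrows into and out of the poset:
    there is one kind of commutativity relation for each of the four positions of
    the ends of the path. *)
Lemma lifted_cong x y q q' p :
  ins_vertex_pred v x -> ins_vertex_pred v y ->
  pstart p = rcoll x -> pend p = rcoll y -> fits x y q -> fits x y q' ->
  lifted v x q p - lifted v x q' p \in (J' : {vspace _}).
Proof.
move=> vx vy sp ep [fx fy] [fx' fy'].
have pw : walk (@src Q) (@tgt Q) (rcoll x) (parrows p).
  by rewrite -sp; apply: qpathP.
have pe : walk_end (@tgt Q) (rcoll x) (parrows p) = rcoll y by rewrite -ep -sp.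
have tail w : walk (@src Q) (@tgt Q) v w -> walk_end (@tgt Q) v w = rcoll y ->
    (w = [::] /\ exists t, y = inr t) \/
    exists b w', [/\ w = b :: w', src b = v, tgt b != v, exists u, y = inl u &
      forall r, thread v r w = outof (pend r) b :: map (old S) w'].
  case/walk_fromP => [->|[b [w' [-> sb nb aw']]]] we.
    left; split=> //; case: (y) vy we => [u|t] vy we; last by exists t.
    by move: vy we; rewrite /ins_vertex_pred /walk_end /= => /eqP nu vu; case: nu; rewrite -vu.
  right; exists b, w'; split=> //; last first.
    by move=> r'; rewrite thread_outof // thread_avoids.
  have := avoids_end nb aw'; rewrite [walk_end _ _ _]we.
  by case: (y) => [u|t] /=; [exists u | rewrite eqxx].
rewrite /lifted /lift_word.
case: x vx sp fx fx' pw pe => [u|s] /= vx sp fx fx' pw pe.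
  have nu : u != v by [].
  have [av|[w1 [a [w2 [ap av1 sa ta ww2]]]]] := walk_throughP nu pw.
    by rewrite !thread_avoids // subrr mem0v.
  have wa : walk_end rtgt (inl u) (map (old S) w1) = inl (src a).
    move: pw; rewrite ap walk_cat /= => /and3P[_ /eqP -> _].
    by rewrite /walk_end; elim: (w1) (u) => /=.
  have e2 : walk_end (@tgt Q) v w2 = rcoll y.
    by rewrite -pe ap /walk_end map_cat last_cat /= ta.
  rewrite ap !thread_cat !(thread_avoids _ av1) !thread_into //.
  have [[-> [t yt]]|[b [w' [-> sb nb [u' yu]  thr]]]] := tail _ ww2 e2.
    rewrite yt in fy fy'.
    rewrite -!cat_cons; apply: word_ctx_mem; rewrite wa.
      rewrite [LHS](proj2 (inner_walk L q)) [RHS](proj2 (inner_walk L q')).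
      by rewrite fy fy'.
    by apply/ins_rel_mem/Rel2b; rewrite // fy fy'.
  rewrite yu in fy fy'.
  have split_thr (r : qpath QS) : into a (pstart r) :: inner_word L r ++ thread v r (b :: w')
      = (into a (pstart r) :: rcons (inner_word L r) (outof (pend r) b))
        ++ map (old S) w'.
    by rewrite thr /= cat_rcons.
  rewrite !split_thr; apply: word_ctx_mem; rewrite wa.
    by rewrite /walk_end /= !map_rcons !last_rcons.
  by apply/ins_rel_mem/Rel2d.
have [[-> [t yt]]|[b [w' [-> sb nb [u' yu]  thr]]]] := tail _ pw pe.
  rewrite yt in fy fy'.
  rewrite !cats0 -{1}fx -{1}fx'.
  by apply/ins_rel_mem/Rel2a; rewrite ?fx ?fy.
rewrite yu in fy fy'; rewrite !thr -!cat_rcons.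
rewrite -[X in word v _ X - _]cat0s -[X in _ - word v _ X]cat0s.
apply: word_ctx_mem; first by rewrite /walk_end /= !map_rcons !last_rcons.
rewrite /walk_end /= -{1}fx -{1}fx'.
by apply/ins_rel_mem/Rel2c; rewrite // fx.
Qed.

(** If only one end is in the poset, then lifting is replacing [v] by an end of [q]
    followed by multiplication with [q], which leaves the relations for paths that
    end, or start, at [v].  Between two elements of the poset there are only
    loops at [v] to lift. *)
Lemma lifted_ideal x y q g :
  ins_vertex_pred v x -> ins_vertex_pred v y -> fits x y q ->
  g \in (J : {vspace _}) -> parallel_comb (rcoll x) (rcoll y) g ->
  path_lin (lifted v x q) g \in (J' : {vspace _}).
Proof.
case: x y => [u|s] [w|t] vx vy [fx fy] Jg par; rewrite /= in fx fy par.
- rewrite (@eq_path_lin _ _ _ _ (path_through v q)); last first.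
    by move=> p /par[<- _].
  by apply: ins_rel_mem; apply: (Rel3 (c := fun=> q) vx vy Jg par).
- have [R RE] : {g : 'Hom(path_alg K Q', path_alg K Q') |
      forall h, g h = h ** word v (inr (pstart q)) (inner_word L q)}.
    by apply: linear_hom => k h h'; rewrite amulPl.
  have -> : path_lin (lifted v (inl u) q) g
      = R (path_lin (path_into v (pstart q)) g).
    rewrite linear_sum; apply: eq_bigr => p _; rewrite linearZ /= RE.
    have [->|/par[sp ep]] := eqVneq (pcoef g p) 0; first by rewrite !scale0r.
    congr (_ *: _); rewrite /lifted /lift_word /= thread_pend ?sp // word_cat.
    rewrite /path_into sp; case ap: (parrows p) => [|a w] /=; last first.
      by rewrite /walk_end map_rcons last_rcons.
    case/negP: vx; rewrite -[u]sp -[X in _ == inl X]ep.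
    by rewrite /pend ap.
  rewrite RE -[X in X ** _]amul1l; apply: idealP; apply: ins_rel_mem.
  exact: Rel1a par.
- have [R RE] : {g : 'Hom(path_alg K Q', path_alg K Q') |
      forall h, g h = word v (inr s) (inner_word L q) ** h}.
    by apply: linear_hom => k h h'; rewrite amulPr.
  have -> : path_lin (lifted v (inr s) q) g
      = R (path_lin (path_outof v (pend q)) g).
    rewrite linear_sum; apply: eq_bigr => p _; rewrite linearZ /= RE.
    have [->|/par[sp ep]] := eqVneq (pcoef g p) 0; first by rewrite !scale0r.
    congr (_ *: _); rewrite /lifted /lift_word thread_pstart ?ep // word_cat.
    by rewrite -fx (proj2 (inner_walk L q)).
  rewrite RE -[X in X \in _]amul1r; apply: idealP; apply: ins_rel_mem.
  exact: Rel1b par.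
- by rewrite (loop_ideal0 _ Jg par) mem0v.
Qed.

End InsertionIdeal.

(** * The Cartan matrix of an insertion *)

Section InsertionCartan.
Variables (K : fieldType) (L : bquiver K) (v : vertex (bq_quiver L)).
Variables (d : Order.disp_t) (S : finPOrderType d) (t0 : S).
Hypothesis triL : is_triangular L.
Local Notation Q := (bq_quiver L).
Local Notation QS := (hasse S).
Local Notation Q' := (ins_quiver v S).
Local Notation J := (bq_ideal L).
Local Notation J' := (bq_ideal (insertion v S)).
Local Notation rcoll := (@raw_collapse K L v d S).
Implicit Types (x y : vertex Q') (q : qpath QS).

Lemma qpath_lift (p : qpath Q') :
  exists2 q, fits (val (pstart p)) (val (pend p)) q &
    pelt K p = lifted v (val (pstart p)) q (collapse_path p).
Proof.
have [ok e] := qpath_raw_ok p; have [q fq eq] := raw_ok_lift t0 ok.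
by exists q; rewrite -?e // /lifted collapse_path_arrows -eq word_pelt.
Qed.

(** On combinations of parallel paths, [f] and the lift of its contraction
    differ by commutativity relations only. *)
Lemma contraction_ideal_par x y q f : fits (val x) (val y) q ->
  parallel_comb x y f ->
  (contraction f \in (J : {vspace _})) = (f \in (J' : {vspace _})).
Proof.
move=> fq par; apply/idP/idP; last exact: contraction_ideal.
move=> Jf.
have parc : parallel_comb (rcoll (val x)) (rcoll (val y)) (contraction f).
  apply/par_spaceP; apply: path_lin_mem => p /par[<- <-].
  by rewrite -collapse_path_start -collapse_path_end pelt_par.
have lift_in := lifted_ideal triL (valP x) (valP y) fq Jf parc.
rewrite -[f](subrK (path_lin (lifted v (val x) q) (contraction f))) rpredD //.
rewrite {1}[f]path_expand [X in _ - X]linear_sum /path_lin -sumrB.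
apply: rpred_sum => p _; rewrite linearZ /= path_lin_pelt -scalerBr.
have [->|/par[sp ep]] := eqVneq (pcoef f p) 0; first by rewrite scale0r mem0v.
apply: rpredZ; have [q' fq' ->] := qpath_lift p.
rewrite sp ep in fq' *.
apply: (lifted_cong (valP x) (valP y)) => //.
  by rewrite collapse_path_start sp.
by rewrite collapse_path_end ep.
Qed.

Lemma cartan_insertion_fits x y q : fits (val y) (val x) q ->
  cartan (fun x : vertex Q' => bq_idem (L := insertion v S) x : bq_alg _) x y
  = cartan (fun x : vertex Q => bq_idem x : bq_alg L)
      (rcoll (val x)) (rcoll (val y)).
Proof.
move=> fq; rewrite !cartan_bq.
have [F FE] : {g : 'Hom(path_alg K Q', path_alg K Q) |
    forall h, g h = contraction h} by apply: linear_hom => k g h; rewrite linearP.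
rewrite (@dim_limg_transfer _ _ _ _ _ _ (bq_pi L) F); last first.
  move=> f /par_spaceP par.
  by rewrite !bq_pi_eq0 FE (contraction_ideal_par fq).
congr (\dim (_ @: _)); apply/vspaceP => g; apply/idP/idP.
  case/memv_imgP => f /par_spaceP par ->; rewrite FE.
  apply: path_lin_mem => p /par[<- <-].
  by rewrite -collapse_path_start -collapse_path_end pelt_par.
move=> /par_spaceP par; rewrite [g]path_expand; apply: path_lin_mem.
move=> p /par[sp ep]; apply/memv_imgP; exists (lifted v (val y) q p).
  by apply: word_par; case: (lift_raw_ok (valP y) (valP x) sp ep fq).
by rewrite FE (contraction_lifted (valP y) (valP x) sp ep fq).
Qed.

(** No path joins two elements of the poset of which the first is not below the
    second.  In all other cases contraction is an isomorphism, and the space at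
    [v] is one-dimensional. *)
Lemma cartan_insertion x y :
  cartan (fun x : vertex Q' => bq_idem (L := insertion v S) x : bq_alg _) x y
  = match val x, val y with
    | inr s, inr t => (t <= s)%O : nat
    | a, b => cartan (fun x : vertex Q => bq_idem x : bq_alg L) (rcoll a) (rcoll b)
    end.
Proof.
have [ord|] := boolP (if val y is inr t then
    if val x is inr s then (t <= s)%O else true else true).
  have [q fq] := @fits_ex K L _ S (val y) (val x) t0 ord.
  rewrite (cartan_insertion_fits fq).
  case: (val x) (val y) ord => [u|s] [w|t] //= ->.
  exact: cartan_diag.
case ex: (val x) => [u|s]; case ey: (val y) => [w|t] //= nts.
rewrite (negbTE nts) cartan_bq; apply/eqP; rewrite -leqn0.
suff -> : par_space K y x = 0%VS by rewrite limg0 dimv0.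
apply/eqP; rewrite -subv0; apply/subvP => f /par_spaceP par.
rewrite [f]path_expand; apply: path_lin_mem => p /par[sp ep].
have [q [qs qe] _] := qpath_lift p.
have := hasse_path_le q; move: qs qe; rewrite sp ep ex ey => -> -> le_ts.
by rewrite le_ts in nts.
Qed.

End InsertionCartan.

(** * Coxeter polynomials as determinants of block matrices *)

Section Determinants.
Variable R : comNzRingType.

Lemma det_castmx n n' (e : n = n') (A : 'M[R]_n) : \det (castmx (e, e) A) = \det A.
Proof. by case: n' / e; rewrite castmx_id. Qed.

(** The middle row of the matrix is the sum of its parts on the first two and on
    the last two blocks, minus the corner [a], which both of them contain.  Each
    summand makes the matrix block triangular. *)
Lemma det_amalgam m k (A : 'M[R]_m) (N : 'M[R]_k) (a : R)
    (p : 'cV_m) (q : 'rV_m) (r : 'rV_k) (c : 'cV_k) :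
  \det (block_mx A (row_mx p 0) (col_mx q 0) (block_mx a%:M r c N)) =
    \det A * \det (block_mx a%:M r c N)
    + \det (block_mx A p q a%:M) * \det N
    - a * \det A * \det N.
Proof.
pose M (b : R) (q' : 'rV_m) (r' : 'rV_k) :=
  block_mx A (row_mx p 0) (col_mx q' 0) (block_mx b%:M r' c N).
pose i0 : 'I_(m + (1 + k)) := rshift m (lshift k ord0).
have rowM b q' r' : row i0 (M b q' r') = row_mx q' (row_mx b%:M r').
  rewrite /M /block_mx rowKd row_row_mx !rowKu row_row_mx.
  by congr row_mx; [|congr row_mx]; apply/rowP => j; rewrite !mxE // !ord1.
have row_oth i b q' r' b' q'' r'' : i != i0 ->
    row i (M b q' r') = row i (M b' q'' r'').
  rewrite /M /block_mx; case: (split_ordP i) => [i1 ->|i1 ->].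
    by rewrite !rowKu.
  rewrite !rowKd !row_row_mx; case: (split_ordP i1) => [i2 ->|i2 ->].
    by rewrite ord1 eqxx.
  by rewrite !rowKd.
have row'M b q' r' b' q'' r'' : row' i0 (M b q' r') = row' i0 (M b' q'' r'').
  apply/matrixP => i j; rewrite [LHS]mxE [RHS]mxE.
  by apply/row_eq/row_oth; rewrite eq_sym neq_lift.
have detD b b' q1 q2 r1 r2 :
    \det (M (b + b') (q1 + q2) (r1 + r2)) = \det (M b q1 r1) + \det (M b' q2 r2).
  rewrite (@determinant_multilinear _ _ _ (M b q1 r1) (M b' q2 r2) i0 1 1) //.
    by rewrite !mul1r.
  by rewrite !rowM !scale1r !add_row_mx -raddfD.
have det_l : \det (M a q 0) = \det (block_mx A p q a%:M) * \det N.
  by rewrite /M block_mxA det_castmx col_mx0 det_lblock.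
have det_r q' r' : q' = 0 -> \det (M a q' r') = \det A * \det (block_mx a%:M r' c N).
  by rewrite /M => ->; rewrite col_mx0 det_ublock.
have := detD a a q 0 0 r; rewrite addr0 add0r det_l det_r //.
have := detD a a q 0 r 0; rewrite !addr0 => ->.
rewrite [\det (M a 0 0)]det_r // det_lblock det_scalar1 -/(M a q r).
by move=> e; rewrite [X in X - _]addrC -e mulrA [_ * a]mulrC addrK.
Qed.

(** Adding multiples [w] of the lower rows to the upper ones, and multiples [z] of
    the right columns to the left ones. *)
Lemma det_block_shear m n (A : 'M[R]_m) (B : 'M_n) (P w : 'M_(m, n))
    (Q z : 'M_(n, m)) :
  \det (block_mx (A + w *m Q + (P + w *m B) *m z) (P + w *m B) (Q + B *m z) B)
    = \det (block_mx A P Q B).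
Proof.
have -> : block_mx (A + w *m Q + (P + w *m B) *m z) (P + w *m B) (Q + B *m z) B
    = block_mx 1%:M w 0 1%:M *m block_mx A P Q B *m block_mx 1%:M 0 z 1%:M.
  by rewrite !mulmx_block !mul1mx !mulmx1 !mul0mx !mulmx0 !add0r.
by rewrite !det_mulmx det_ublock det_lblock !det1 !mul1r mulr1.
Qed.

End Determinants.

(** * The formula *)

Section CoxeterBlocks.

Lemma det_reindex (R : comNzRingType) (I : finType) (F : I -> I -> R) n
    (f : 'I_n -> I) : injective f -> (forall x, exists i, f i = x) ->
  \det (\matrix_(i < #|I|, j < #|I|) F (enum_val i) (enum_val j))
    = \det (\matrix_(i, j) F (f i) (f j)).
Proof.
move=> injf surjf.
have en : #|I| = n.
  rewrite -[RHS]card_ord -(card_codom injf); apply: eq_card => x.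
  by have [i <-] := surjf x; rewrite codom_f.
case: n / en f injf {surjf} => f injf.
have injg : injective (fun i => enum_rank (f i)).
  by move=> i j /enum_rank_inj/injf.
pose s := perm.perm injg.
set M := \matrix_(i, j) F (enum_val i) (enum_val j).
have -> : \matrix_(i, j) F (f i) (f j) = row_perm s (col_perm s M).
  by apply/matrixP => i j; rewrite !mxE !permE !enum_rankK.
rewrite row_permE col_permE !det_mulmx !det_perm odd_permV mulrCA -signr_addb.
by rewrite addbb mulr1.
Qed.

Definition cox_entry (I : Type) (C : I -> I -> nat) (x y : I) : {poly int} :=
  'X * (C x y)%:R + (C y x)%:R.

Lemma coxeter_polyE (I : finType) (C : I -> I -> nat) n (f : 'I_n -> I) :
  injective f -> (forall x, exists i, f i = x) ->
  coxeter_poly C = \det (\matrix_(i, j) cox_entry C (f i) (f j)).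
Proof.
move=> injf surjf; rewrite -(det_reindex (cox_entry C) injf surjf).
congr (\det _); apply/matrixP => i j; rewrite !mxE /cox_entry.
by rewrite -!polyC_natr !natz.
Qed.

Lemma coxeter_poly_vertex (I : finType) (v : I) (C : I -> I -> nat) k
    (f : 'I_k -> {x : I | x != v}) :
  bijective f -> C v v = 1%N ->
  coxeter_poly C = \det (block_mx ('X + 1)%:M
    (\row_j cox_entry C v (val (f j))) (\col_i cox_entry C (val (f i)) v)
    (\matrix_(i, j) cox_entry C (val (f i)) (val (f j)))).
Proof.
move=> [g fK gK] Cvv.
pose h (i : 'I_(1 + k)) := match split i with inl _ => v | inr j => val (f j) end.
have hl i : h (lshift k i) = v.
  by rewrite /h -[lshift k i]/(unsplit (inl i)) unsplitK.
have hr i : h (rshift 1 i) = val (f i).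
  by rewrite /h -[rshift 1 i]/(unsplit (inr i)) unsplitK.
rewrite (@coxeter_polyE _ C _ h).
- congr (\det _); apply/matrixP => i j; rewrite mxE.
  case: (split_ordP i) => [i1 ->|i1 ->]; case: (split_ordP j) => [j1 ->|j1 ->].
  + rewrite block_mxEul !hl !ord1 mxE eqxx /cox_entry Cvv mulr1.
    by rewrite mulr1n.
  + by rewrite block_mxEur hl hr !mxE.
  + by rewrite block_mxEdl hl hr !mxE.
  + by rewrite block_mxEdr !hr !mxE.
- move=> i j; case: (split_ordP i) => [i1 ->|i1 ->];
    case: (split_ordP j) => [j1 ->|j1 ->]; rewrite ?hl ?hr ?ord1 //.
  + by move=> e; have := valP (f j1); rewrite -e eqxx.
  + by move=> e; have := valP (f i1); rewrite e eqxx.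
  + by move=> /val_inj/(can_inj fK) ->.
- move=> x; have [->|nx] := eqVneq x v; first by exists (lshift k ord0).
  by exists (rshift 1 (g (Sub x nx))); rewrite hr gK.
Qed.

End CoxeterBlocks.

Theorem corollary3p25 (K : fieldType) (L : bquiver K)
    (v : vertex (bq_quiver L)) (d : Order.disp_t) (S : finPOrderType d)
    (triL : is_triangular L) :
  coxeter (insertion v (hat S)) =
    coxeter L * coxeter_poset S
    + coxeter_corner v * coxeter_poset (hat S)
    - ('X + 1) * coxeter_corner v * coxeter_poset S.
Proof.
pose C := cartan (fun x : vertex (bq_quiver L) => bq_idem x : bq_alg L).
pose m := #|S|; pose k := #|{: {x : vertex (bq_quiver L) | x != v}}|.
pose fS : 'I_m -> S := enum_val.
pose fO : 'I_k -> {x : vertex (bq_quiver L) | x != v} := enum_val.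
have fS_inj : injective fS := enum_val_inj.
have fO_inj : injective fO := enum_val_inj.
have fS_surj s : exists i, fS i = s by exists (enum_rank s); apply: enum_rankK.
have fO_surj x : exists i, fO i = x by exists (enum_rank x); apply: enum_rankK.
pose A : 'M_m := \matrix_(i, j)
  cox_entry (fun s t : S => (t <= s)%O : nat) (fS i) (fS j).
pose N : 'M_k := \matrix_(i, j) cox_entry C (val (fO i)) (val (fO j)).
pose r : 'rV_k := \row_j cox_entry C v (val (fO j)).
pose c : 'cV_k := \col_i cox_entry C (val (fO i)) v.
pose u : 'cV[{poly int}]_m := const_mx 1.
have detS : coxeter_poset S = \det A by apply: coxeter_polyE.
have detL : coxeter L = \det (block_mx ('X + 1)%:M r c N).
  apply: coxeter_poly_vertex; last exact: cartan_diag.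
  by exists enum_rank; [apply: enum_valK | apply: enum_rankK].
have detN : coxeter_corner v = \det N.
  rewrite /coxeter_corner (coxeter_polyE _ fO_inj fO_surj); congr (\det _).
  by apply/matrixP => i j; rewrite !mxE /cox_entry !cartan_corner.
have detH : coxeter_poset (hat S)
    = \det (block_mx A u ('X *: u^T) ('X + 1)%:M).
  pose h (i : 'I_(m + 1)) : hat S :=
    if split i is inl j then Some (fS j) else None.
  have hl i : h (lshift 1 i) = Some (fS i).
    by rewrite /h -[lshift 1 i]/(unsplit (inl i)) unsplitK.
  have hr i : h (rshift m i) = None.
    by rewrite /h -[rshift m i]/(unsplit (inr i)) unsplitK.
  rewrite /coxeter_poset (@coxeter_polyE _ _ _ h).
  - congr (\det _); apply/matrixP => i j; rewrite mxE.
    case: (split_ordP i) => [i1 ->|i1 ->]; case: (split_ordP j) => [j1 ->|j1 ->].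
    + by rewrite block_mxEul !hl mxE.
    + by rewrite block_mxEur hl hr mxE /cox_entry /= mulr0 add0r.
    + by rewrite block_mxEdl hl hr !mxE /cox_entry /= addr0.
    + by rewrite block_mxEdr !hr !ord1 !mxE /cox_entry /= mulr1.
  - move=> i j; case: (split_ordP i) => [i1 ->|i1 ->];
      case: (split_ordP j) => [j1 ->|j1 ->]; rewrite ?hl ?hr ?ord1 //.
    by move=> [/fS_inj ->].
  - case=> [s|]; last by exists (rshift m ord0).
    by have [i <-] := fS_surj s; exists (lshift 1 i).
have detI : coxeter (insertion v (hat S)) =
    \det (block_mx A (row_mx u (u *m r)) (col_mx ('X *: u^T) (c *m u^T))
           (block_mx ('X + 1)%:M r c N)).
  pose vS (s : hat S) : ins_vertex v (hat S) := exist _ (inr s) isT.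
  pose vO (x : {x : vertex (bq_quiver L) | x != v}) : ins_vertex v (hat S) :=
    exist _ (inl (val x)) (valP x).
  pose h (i : 'I_(m + (1 + k))) : ins_vertex v (hat S) :=
    match split i with
    | inl j => vS (Some (fS j))
    | inr j => match split j with inl _ => vS None | inr j' => vO (fO j') end
    end.
  have hl i : h (lshift _ i) = vS (Some (fS i)).
    by rewrite /h -[lshift _ i]/(unsplit (inl i)) unsplitK.
  have hm i : h (rshift m (lshift k i)) = vS None.
    rewrite /h -[rshift m _]/(unsplit (inr (unsplit (inl i)))).
    by rewrite unsplitK unsplitK.
  have hr i : h (rshift m (rshift 1 i)) = vO (fO i).
    rewrite /h -[rshift m _]/(unsplit (inr (unsplit (inr i)))).
    by rewrite unsplitK unsplitK.
  pose CI := cartan (fun x : vertex (ins_quiver v (hat S)) =>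
    bq_idem (L := insertion v (hat S)) x : bq_alg _).
  (* the top element witnesses that the inserted poset is nonempty *)
  have CIE x y := @cartan_insertion K L v d (hat S) None triL x y.
  have eS s t : cox_entry CI (vS s) (vS t)
      = 'X * (t <= s)%O%:R + (s <= t)%O%:R by rewrite /cox_entry /CI !CIE.
  have eSO s x : cox_entry CI (vS s) (vO x) = cox_entry C v (val x).
    by rewrite /cox_entry /CI !CIE.
  have eOS s x : cox_entry CI (vO x) (vS s) = cox_entry C (val x) v.
    by rewrite /cox_entry /CI !CIE.
  have eO x y : cox_entry CI (vO x) (vO y) = cox_entry C (val x) (val y).
    by rewrite /cox_entry /CI !CIE.
  rewrite /coxeter (@coxeter_polyE _ _ _ h).
  - congr (\det _); apply/matrixP => i j; rewrite mxE -/CI.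
    case: (split_ordP i) => [{}i ->|{}i ->]; last case: (split_ordP i) => {}i ->;
      (case: (split_ordP j) => [{}j ->|{}j ->]; last case: (split_ordP j) => {}j ->);
      rewrite ?hl ?hm ?hr ?eS ?eSO ?eOS ?eO.
    + by rewrite block_mxEul mxE.
    + by rewrite block_mxEur row_mxEl mxE /= mulr0 add0r.
    + by rewrite block_mxEur row_mxEr !mxE big_ord1 !mxE mul1r.
    + by rewrite block_mxEdl col_mxEu !mxE /= addr0.
    + by rewrite block_mxEdr block_mxEul !ord1 mxE eqxx /= mulr1 mulr1n.
    + by rewrite block_mxEdr block_mxEur mxE.
    + by rewrite block_mxEdl col_mxEd !mxE big_ord1 !mxE mulr1.
    + by rewrite block_mxEdr block_mxEdl mxE.
    + by rewrite block_mxEdr block_mxEdr mxE.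
  - move=> i j.
    case: (split_ordP i) => [{}i ->|{}i ->]; last case: (split_ordP i) => {}i ->;
      (case: (split_ordP j) => [{}j ->|{}j ->]; last case: (split_ordP j) => {}j ->);
      rewrite ?hl ?hm ?hr ?ord1 // => /(congr1 val) [].
      by move=> /fS_inj ->.
    by move=> /val_inj /fO_inj ->.
  - case=> [[x|[s|]] nx].
    + have [i e] := fO_surj (Sub x nx); exists (rshift m (rshift 1 i)).
      by rewrite hr e; apply: val_inj.
    + have [i e] := fS_surj s; exists (lshift _ i).
      by rewrite hl e; apply: val_inj.
    + by exists (rshift m (lshift k ord0)); rewrite hm; apply: val_inj.
(* [p] and [q] are the entries of the column and the row of the top element in
   the columns and rows of [S], after the subtraction that clears [u *m r] and
   [c *m u^T]; subtracting this column and row from the others has no effect on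
   [A], as the two changes cancel. *)
pose p : 'cV_m := - ('X *: u); pose q : 'rV_m := - u^T.
have top_u : p + u *m ('X + 1)%:M = u.
  by rewrite mul_mx_scalar scalerDl scale1r addKr.
have top_uT : q + ('X + 1)%:M *m u^T = 'X *: u^T.
  by rewrite mul_scalar_mx scalerDl scale1r addrC addrK.
have -> : coxeter_poset (hat S) = \det (block_mx A p q ('X + 1)%:M).
  rewrite detH -(det_block_shear A _ p u q u^T) top_u top_uT.
  by rewrite mulmxN subrK.
have -> : coxeter (insertion v (hat S)) = \det (block_mx A (row_mx p 0)
    (col_mx q 0) (block_mx ('X + 1)%:M r c N)).
  rewrite detI -(det_block_shear A _ (row_mx p 0) (row_mx u 0) (col_mx q 0)
    (col_mx u^T 0)).
  rewrite !mul_row_block !mul_block_col !mul_row_col !mul0mx !mulmx0 !addr0.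
  rewrite add_row_mx add_col_mx top_u top_uT !add0r.
  by rewrite mul_row_col mulmx0 addr0 mulmxN subrK.
rewrite det_amalgam detS detL detN.
rewrite [\det N * _]mulrC [\det A * _]mulrC -[_ * \det A * _]mulrA.
by rewrite [\det A * \det N]mulrC mulrA.
Qed.
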